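(* Let $K$ be a perfect field, and let $\mathcal{P}$ be a finite set of cells of $\mathbb{Z}^2$ such that the cell ideal $I_{\mathcal{P}}\subset S=K[x_{\mathbf a} : \mathbf a\in V(\mathcal{P})]$ is a prime ideal. Then $S/I_{\mathcal{P}}$ has an isolated singularity if and only if $\mathcal{P}$ is an inner interval.
   Context: Partially order $\mathbb{Z}^2$ by $(i,j)\leq (i',j')$ if $i\leq i'$ and $j\leq j'$. For $\mathbf a,\mathbf b\in\mathbb{Z}^2$ the set $[\mathbf a,\mathbf b]=\{\mathbf c\in\mathbb{Z}^2 : \mathbf a\leq\mathbf c\leq\mathbf b\}$ is called an interval; with $\mathbf a=(i,j)$, $\mathbf b=(i',j')$ it is called proper if $i<i'$ and $j<j'$, and in that case its diagonal corners are $\mathbf a,\mathbf b$ and its anti-diagonal corners are $(i,j')$ and $(i',j)$. A cell is an interval $C=[\mathbf a,\mathbf a+(1,1)]$; its vertex set is $V(C)=\{\mathbf a,\mathbf a+(1,0),\mathbf a+(0,1),\mathbf a+(1,1)\}$. A cell $[\mathbf a',\mathbf b']$ is a cell of the proper interval $[\mathbf a,\mathbf b]$ if $\mathbf a\leq\mathbf a'$ and $\mathbf b'\leq\mathbf b$. Let $\mathcal{P}$ be a finite set of cells (no connectedness is assumed). Put $V(\mathcal{P})=\bigcup_{C\in\mathcal{P}}V(C)$. A proper interval $[\mathbf a,\mathbf b]$ is an inner interval of $\mathcal{P}$ if every cell of $[\mathbf a,\mathbf b]$ belongs to $\mathcal{P}$. Saying that $\mathcal{P}$ is an inner interval means that there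 is a proper interval $[\mathbf a,\mathbf b]$ of $\mathbb{Z}^2$ such that $\mathcal{P}$ is exactly the set of all cells of $[\mathbf a,\mathbf b]$. Let $S=K[x_{\mathbf a} : \mathbf a\in V(\mathcal{P})]$ be the polynomial ring over $K$ in $|V(\mathcal{P})|$ variables. For each inner interval $[\mathbf a,\mathbf b]$ of $\mathcal{P}$ with anti-diagonal corners $\mathbf c,\mathbf d$, the inner $2$-minor is $f_{\mathbf a,\mathbf b}=x_{\mathbf a}x_{\mathbf b}-x_{\mathbf c}x_{\mathbf d}$. The cell ideal $I_{\mathcal{P}}\subset S$ is the ideal generated by all inner $2$-minors of $\mathcal{P}$. The ring $R=S/I_{\mathcal{P}}$ has an isolated singularity if its singular locus $\{Q\in\operatorname{Spec}(R) : R_Q \text{ is not regular}\}$ is zero-dimensional. Since $R$ is a standard graded $K$-algebra, this means that the singular locus consists exactly of the graded maximal ideal generated by the residue classes of all the variables $x_{\mathbf a}$, $\mathbf a\in V(\mathcal{P})$. Equivalently (as $K$ is perfect), $\dim R/J=0$, where $J\subset R$ is the Jacobian ideal of $R$, i.e. the ideal generated by the images of the $h\times h$-minors of the Jacobian matrix of a generating set of $I_{\mathcal{P}}$, with $h=\operatorname{height} I_{\mathcal{P}}$. *)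

(* Defs.v *)
From HB Require Import structures.
From mathcomp Require Import all_boot all_order all_algebra all_field finmap.
From mathcomp Require Import generic_quotient ring_quotient.
From mathcomp Require Import boolp classical_sets.
From mathcomp Require Import mpoly ring.

Set Implicit Arguments.
Unset Strict Implicit.
Unset Printing Implicit Defensive.

Import Order.TTheory GRing.Theory Num.Theory.
Local Open Scope ring_scope.
Local Open Scope quotient_scope.
Local Open Scope classical_set_scope.

Definition perfect_field (K : fieldType) : Prop :=
  forall p : {poly K}, irreducible_poly p -> separable_poly p.

Definition ideal_gen (A : comNzRingType) (G : set A) : {pred A} := fun f =>
  `[< exists n (c g : 'I_n -> A),
        (forall i, G (g i)) /\ f = \sum_(i < n) c i * g i >].

Lemma ideal_gen_closed (A : comNzRingType) (G : set A) :
  1 \notin ideal_gen G -> idealr_closed (ideal_gen G).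
Proof.
move=> G1; split=> // [|a x y /asboolP[n [c [g [Gg ->]]]] /asboolP[m [d [h [Gh ->]]]]].
  apply/asboolP; exists 0%N, (fun=> 0), (fun=> 0); split; first by case.
  by rewrite big_ord0.
apply/asboolP; exists (n + m)%N,
  (fun k => match split k with inl i => a * c i | inr j => d j end),
  (fun k => match split k with inl i => g i | inr j => h j end).
split=> [k|]; first by case: (split k).
rewrite big_split_ord mulr_sumr /=; congr (_ + _); apply: eq_bigr => i _.
  by rewrite (unsplitK (inl i)) mulrA.
by rewrite (unsplitK (inr i)).
Qed.

(* [idealr_closed] describes proper ideals; the unit ideal is generated by 1. *)
Definition noetherian (A : comNzRingType) : Prop :=
  forall I : {pred A}, idealr_closed I ->
    exists n (g : 'I_n -> A), I =i ideal_gen (range g).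

Definition maximal_ideal (A : comNzRingType) (M : {pred A}) : Prop :=
  idealr_closed M /\
  forall J : {pred A}, idealr_closed J -> {subset M <= J} -> J =i M.

Definition local_with_max (A : comNzRingType) (M : {pred A}) : Prop :=
  maximal_ideal M /\ forall M' : {pred A}, maximal_ideal M' -> M' =i M.

Definition prime_ideal (A : comNzRingType) (P : {pred A}) : Prop :=
  idealr_closed P /\ prime_idealr_closed P.

(* The bundled [prime_idealr A] lives in a universe too large for [set]. *)
Record Spec (A : comNzRingType) := MkSpec {
  prime_fun : A -> bool;
  prime_funP : @prime_ideal A prime_fun
}.

Coercion prime_pred (A : comNzRingType) (Q : Spec A) : {pred A} := prime_fun Q.

Definition has_chain (U : Type) (F : set (set U)) (n : nat) : Prop :=
  exists c : nat -> set U,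
    (forall i, (i <= n)%N -> F (c i)) /\
    (forall i, (i < n)%N -> c i `<` c i.+1).

(* n is the maximal length of a strict chain of members of F; in particular F
   is nonempty. *)
Definition chain_dim (U : Type) (F : set (set U)) (n : nat) : Prop :=
  has_chain F n /\ forall m, has_chain F m -> (m <= n)%N.

Definition krull_dim (A : comNzRingType) (n : nat) : Prop :=
  chain_dim (range (fun Q : Spec A => [set x | x \in Q])) n.

Definition regular_local_ring (A : comNzRingType) : Prop :=
  noetherian A /\
  exists (M : {pred A}) (n : nat),
    [/\ local_with_max M, krull_dim A n &
        exists g : 'I_n -> A, M =i ideal_gen (range g)].

Module Localization.
Section Localization.
Variables (A : comNzRingType) (Q : Spec A).

Lemma notin_prime1 : 1 \notin Q.
Proof. by case: (prime_funP Q) => -[]. Qed.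

Lemma notin_primeM s t : s \notin Q -> t \notin Q -> s * t \notin Q.
Proof.
by move=> sQ tQ; apply/negP => /(proj2 (prime_funP Q)); rewrite (negPf sQ) (negPf tQ).
Qed.

(* the pair (a, s), with s outside Q, stands for the fraction a / s *)
Definition fracpair := {x : A * A | x.2 \notin Q}.
#[export] HB.instance Definition _ := Choice.on fracpair.

Implicit Types x y z : fracpair.

Definition num x : A := (val x).1.
Definition den x : A := (val x).2.

Lemma den_notin x : den x \notin Q. Proof. exact: valP x. Qed.

Definition mkfrac (a s : A) (sQ : s \notin Q) : fracpair :=
  exist (fun x : A * A => x.2 \notin Q) (a, s) sQ.

Lemma fracE a s (sQ : s \notin Q) :
  (num (mkfrac a sQ) = a) * (den (mkfrac a sQ) = s).
Proof. by []. Qed.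

Definition equiv x y : bool :=
  `[< exists2 u, u \notin Q & u * (num x * den y - num y * den x) = 0 >].

Lemma equiv_is_equiv : equiv_class_of equiv.
Proof.
split=> [x|x y|y x z].
- by apply/asboolP; exists 1; rewrite ?notin_prime1 // subrr mulr0.
- by apply/asboolP/asboolP=> -[u uQ e]; exists u => //;
    rewrite -opprB mulrN e oppr0.
- move=> /asboolP[u uQ eu] /asboolP[v vQ ev]; apply/asboolP.
  exists (u * v * den y); first by rewrite !notin_primeM ?den_notin.
  have -> : u * v * den y * (num x * den z - num z * den x) =
     v * den z * (u * (num x * den y - num y * den x)) +
     u * den x * (v * (num y * den z - num z * den y)) by ring.
  by rewrite eu ev !mulr0 addr0.
Qed.

Canonical equiv_equiv := EquivRelPack equiv_is_equiv.
Canonical equiv_encModRel := defaultEncModRel equiv.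

Definition loc := {eq_quot equiv}.
#[export] HB.instance Definition _ : EqQuotient _ equiv loc := EqQuotient.on loc.
#[export] HB.instance Definition _ := Choice.on loc.

Lemma eq_locP x y :
  reflect (exists2 u, u \notin Q & u * (num x * den y - num y * den x) = 0)
          (x == y %[mod loc]).
Proof. by rewrite piE; exact: asboolP. Qed.

Lemma eq_loc x y : num x * den y = num y * den x -> x = y %[mod loc].
Proof.
move=> e; apply/eqP/eq_locP; exists 1; first exact: notin_prime1.
by rewrite e subrr mulr0.
Qed.

Lemma reprP x : exists2 u, u \notin Q &
  u * (num (repr (\pi_loc x)) * den x - num x * den (repr (\pi_loc x))) = 0.
Proof. by apply/eq_locP; rewrite reprK. Qed.

Definition addf x y : fracpair :=
  mkfrac (num x * den y + num y * den x)
         (notin_primeM (den_notin x) (den_notin y)).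
Definition mulf x y : fracpair :=
  mkfrac (num x * num y) (notin_primeM (den_notin x) (den_notin y)).
Definition oppf x : fracpair := mkfrac (- num x) (den_notin x).

Definition zero : loc := lift_cst loc (mkfrac 0 notin_prime1).
Definition one : loc := lift_cst loc (mkfrac 1 notin_prime1).
Definition add := lift_op2 loc addf.
Definition mul := lift_op2 loc mulf.
Definition opp := lift_op1 loc oppf.

Canonical pi_zero_morph := PiConst zero.
Canonical pi_one_morph := PiConst one.

Lemma pi_opp : {morph \pi_loc : x / oppf x >-> opp x}.
Proof.
move=> x; unlock opp; apply/eqP/eq_locP; case: (reprP x) => u uQ.
set x' := repr _ => e; exists u => //.
change (u * (- num x * den x' - - num x' * den x) = 0).
by rewrite !mulNr opprK addrC.
Qed.
Canonical pi_opp_morph := PiMorph1 pi_opp.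

Lemma pi_add : {morph \pi_loc : x y / addf x y >-> add x y}.
Proof.
move=> x y; unlock add; apply/eqP/eq_locP.
case: (reprP x) (reprP y) => u uQ e [v vQ f].
exists (u * v); first exact: notin_primeM.
move: e f; set x' := repr _; set y' := repr _ => e f.
change (u * v * ((num x * den y + num y * den x) * (den x' * den y') -
    (num x' * den y' + num y' * den x') * (den x * den y)) = 0).
have -> : u * v * ((num x * den y + num y * den x) * (den x' * den y') -
    (num x' * den y' + num y' * den x') * (den x * den y)) =
  - (v * den y * den y' * (u * (num x' * den x - num x * den x'))
   + u * den x * den x' * (v * (num y' * den y - num y * den y'))) by ring.
by rewrite e f !mulr0 addr0 oppr0.
Qed.
Canonical pi_add_morph := PiMorph2 pi_add.

Lemma pi_mul : {morph \pi_loc : x y / mulf x y >-> mul x y}.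
Proof.
move=> x y; unlock mul; apply/eqP/eq_locP.
case: (reprP x) (reprP y) => u uQ e [v vQ f].
exists (u * v); first exact: notin_primeM.
move: e f; set x' := repr _; set y' := repr _ => e f.
change (u * v * (num x * num y * (den x' * den y') -
    num x' * num y' * (den x * den y)) = 0).
have -> : u * v * (num x * num y * (den x' * den y') -
    num x' * num y' * (den x * den y)) =
  - (v * num y * den y' * (u * (num x' * den x - num x * den x'))
   + u * num x' * den x * (v * (num y' * den y - num y * den y'))) by ring.
by rewrite e f !mulr0 addr0 oppr0.
Qed.
Canonical pi_mul_morph := PiMorph2 pi_mul.

Lemma addA : associative add.
Proof.
move=> x y z; rewrite -[x]reprK -[y]reprK -[z]reprK !piE.
by apply: eq_loc; rewrite !fracE; ring.
Qed.

Lemma addC : commutative add.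
Proof.
move=> x y; rewrite -[x]reprK -[y]reprK !piE.
by apply: eq_loc; rewrite !fracE; ring.
Qed.

Lemma add0 : left_id zero add.
Proof.
move=> x; rewrite -[x]reprK !piE.
by apply: eq_loc; rewrite !fracE; ring.
Qed.

Lemma addN : left_inverse zero opp add.
Proof.
move=> x; rewrite -[x]reprK !piE.
by apply: eq_loc; rewrite !fracE; ring.
Qed.

#[export] HB.instance Definition _ := GRing.isZmodule.Build loc addA addC add0 addN.

Lemma mulA : associative mul.
Proof.
move=> x y z; rewrite -[x]reprK -[y]reprK -[z]reprK !piE.
by apply: eq_loc; rewrite !fracE; ring.
Qed.

Lemma mulC : commutative mul.
Proof.
move=> x y; rewrite -[x]reprK -[y]reprK !piE.
by apply: eq_loc; rewrite !fracE; ring.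
Qed.

Lemma mul1 : left_id one mul.
Proof.
move=> x; rewrite -[x]reprK !piE.
by apply: eq_loc; rewrite !fracE; ring.
Qed.

Lemma mul_addl : left_distributive mul add.
Proof.
move=> x y z; rewrite -[x]reprK -[y]reprK -[z]reprK !piE.
by apply: eq_loc; rewrite !fracE; ring.
Qed.

Lemma one_neq0 : one != zero.
Proof.
rewrite !piE; apply/negP => /asboolP[u uQ].
rewrite !fracE mulr1 mul0r subr0 mulr1 => u0.
by case: (prime_funP Q) => -[Q0 _ _] _; rewrite u0 Q0 in uQ.
Qed.

#[export] HB.instance Definition _ := GRing.Zmodule_isComNzRing.Build loc
  mulA mulC mul1 mul_addl one_neq0.

End Localization.
Module Exports. HB.reexport. End Exports.
End Localization.
Export Localization.Exports.

Definition localization (A : comNzRingType) (Q : Spec A) : comNzRingType :=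
  Localization.loc Q.

Definition singular_locus (A : comNzRingType) : set (Spec A) :=
  [set Q | ~ regular_local_ring (localization Q)].

Definition zariski_closed (A : comNzRingType) (Z : set (Spec A)) : Prop :=
  exists E : set A, Z = [set Q : Spec A | forall f, E f -> f \in Q].

Definition irreducible_set (A : comNzRingType) (F : set (Spec A)) : Prop :=
  F !=set0 /\
  forall C1 C2, zariski_closed C1 -> zariski_closed C2 ->
    F `<=` C1 `|` C2 -> F `<=` C1 \/ F `<=` C2.

(* dimension of Z as a topological space, for the topology induced by the
   Zariski topology of Spec A *)
Definition dim_subspace (A : comNzRingType) (Z : set (Spec A)) (n : nat) : Prop :=
  chain_dim [set F | irreducible_set F /\
                     exists2 C, zariski_closed C & F = Z `&` C] n.

Definition isolated_singularity (A : comNzRingType) : Prop :=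
  dim_subspace (@singular_locus A) 0.

Notation Z2 := (int *p int)%type.

Section Cells.
Implicit Types (a b c v : Z2) (P : {fset Z2}).

Definition proper_interval a b : bool := (a.1 < b.1) && (a.2 < b.2).

(* A cell [c, c + (1,1)] is represented by its lower left corner c, and a finite
   set of cells by the finite set of these corners. *)
Definition cell_upper c : Z2 := (c.1 + 1, c.2 + 1).

Definition cell_vertices c : {fset Z2} :=
  [fset c; ((c.1 + 1)%R, c.2); (c.1, (c.2 + 1)%R); cell_upper c]%fset.

Definition cell_of a b c : bool := (a <= c)%O && (cell_upper c <= b)%O.

Definition vertices P : {fset Z2} := (\bigcup_(c <- P) cell_vertices c)%fset.

Definition inner_interval P a b : Prop :=
  proper_interval a b /\ forall c, cell_of a b c -> c \in P.

Definition is_inner_interval P : Prop :=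
  exists a b, proper_interval a b /\ forall c, (c \in P) = cell_of a b c.

Variable K : fieldType.

Definition cell_ring P : comNzRingType := {mpoly K[#|{: vertices P}|]}.

Definition cell_var P (v : vertices P) : cell_ring P := 'X_(enum_rank v).

(* Quantifying over corners in [vertices P] loses nothing: the four corners of
   an inner interval are vertices of P. *)
Definition inner_minors P : set (cell_ring P) :=
  [set f | exists a b c d : vertices P,
     [/\ inner_interval P (val a) (val b),
         val c = ((val a).1, (val b).2),
         val d = ((val b).1, (val a).2) &
         f = cell_var a * cell_var b - cell_var c * cell_var d]].

Definition cell_ideal P : {pred cell_ring P} := ideal_gen (@inner_minors P).
Arguments cell_ideal P : clear implicits.

Lemma cell_ideal_proper P : 1 \notin cell_ideal P.
Proof.
apply/asboolPn => -[n [c [g [Gg /(congr1 (mpoly.meval (fun=> 0)))]]]].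
rewrite rmorph1 rmorph_sum /= big1 => [/eqP|i _].
  by rewrite oner_eq0.
have [a [b [a' [b' [_ _ _ ->]]]]] := Gg i.
by rewrite rmorphM rmorphB !rmorphM /= !mevalXU !mulr0 subrr mulr0.
Qed.

HB.instance Definition _ P := isIdealr.Build (cell_ring P) (cell_ideal P)
  (ideal_gen_closed (cell_ideal_proper P)).

End Cells.

Arguments cell_ideal K P : clear implicits.

(* Main.v *)
(* Let V be the vertex set and A = S / I, a domain.  In A, each cell expresses the
   variable of its upper corner as x_c x_d / x_a, so Frac A is generated by
   |V| - |P| variables and chains of primes below Q have length at most
   |V| - |P| - t when t elements are independent modulo Q.  On the other hand
   derivations bound from below the number of generators of Q A_Q.  At the origin
   they give |V| generators, so A is singular there as soon as P is nonempty.  At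
   the generic point of the axis of a vertex v they give |V| - 1 - r(v), where r(v)
   is the number of vertices opposite to v in an inner interval; since t = 1 there,
   regularity forces r(v) >= |P|.  Sending an opposite vertex w to the cell of the
   interval adjacent to w is injective, so every cell is the end of an inner interval
   starting at v; if this holds for all v, then P is an interval.  Conversely, if P is
   an interval and x_v is not in Q, then the variables in the row and the column of v
   are algebraically independent and generate A[1/x_v] together with 1/x_v, so A_Q
   is a localization of a polynomial ring. *)

Require Import Defs.
From HB Require Import structures.
From mathcomp Require Import all_boot all_order all_algebra finmap.
From mathcomp Require Import generic_quotient ring_quotient.
From mathcomp Require Import boolp classical_sets.
From mathcomp Require Import mpoly ring zify.

Set Implicit Arguments.
Unset Strict Implicit.
Unset Printing Implicit Defensive.

Import Order.TTheory GRing.Theory Num.Theory.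
Local Open Scope ring_scope.

(** * Finitely generated ideals and Hilbert's basis theorem *)

Section Span.
Variable A : comNzRingType.
Implicit Types (l : seq A) (x y a : A) (I J : A -> Prop).

(** The ideal generated by a list, with one coefficient peeled off per generator so that proofs go
    by induction on the list instead of handling families of coefficients. *)
Fixpoint span l x : Prop :=
  if l is g :: l' then exists a, span l' (x - a * g) else x = 0.

(** Unlike [idealr_closed], this allows the unit ideal: ideals of leading coefficients and preimages
    of ideals need not be proper. *)
Definition weak_ideal I : Prop :=
  I 0 /\ forall a x y, I x -> I y -> I (a * x + y).

Definition fg_ideal I : Prop :=
  exists l, (forall x, x \in l -> I x) /\ forall x, I x -> span l x.

Lemma weak_idealM I a x : weak_ideal I -> I x -> I (a * x).
Proof. by move=> [I0 IM] Ix; rewrite -[_ * _]addr0; apply: IM. Qed.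

Lemma weak_idealD I x y : weak_ideal I -> I x -> I y -> I (x + y).
Proof. by move=> [I0 IM] Ix Iy; rewrite -[x]mul1r; apply: IM. Qed.

Lemma weak_idealB I x y : weak_ideal I -> I x -> I y -> I (x - y).
Proof. by move=> [I0 IM] Ix Iy; rewrite addrC -mulN1r; apply: IM. Qed.

Lemma weak_ideal_sum I n (c g : 'I_n -> A) :
  weak_ideal I -> (forall i, I (g i)) -> I (\sum_(i < n) c i * g i).
Proof.
move=> wI Ig; elim/big_ind: _ => [|x y|i _]; first by case: wI.
  exact: weak_idealD.
exact: weak_idealM.
Qed.

Lemma span_weak_ideal l : weak_ideal (span l).
Proof.
elim: l => [|g l [IH0 IHM]] /=; first by split=> // a x y -> ->; rewrite mulr0 addr0.
split; first by exists 0; rewrite mul0r subr0.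
move=> a x y [b xb] [c yc]; exists (a * b + c).
have -> : a * x + y - (a * b + c) * g = a * (x - b * g) + (y - c * g) by ring.
exact: IHM.
Qed.

Lemma span_mem l x : x \in l -> span l x.
Proof.
elim: l => [|g l IH] //=; rewrite inE => /orP[/eqP->|/IH xl].
  by exists 1; rewrite mul1r subrr; case: (span_weak_ideal l).
by exists 0; rewrite mul0r subr0.
Qed.

Lemma span_min l I x :
  weak_ideal I -> (forall y, y \in l -> I y) -> span l x -> I x.
Proof.
move=> wI; elim: l x => [|g l IH] x Il /=; first by move=> ->; case: wI.
move=> [a /IH xI]; rewrite -[x](subrK (a * g)); apply: weak_idealD => //.
  by apply: xI => y yl; apply: Il; rewrite inE yl orbT.
by apply: weak_idealM => //; apply: Il; rewrite mem_head.
Qed.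

Lemma ideal_gen_weak (G : set A) : weak_ideal (fun x => x \in ideal_gen G).
Proof.
split=> [|a x y /asboolP[n [c [g [Gg ->]]]] /asboolP[m [d [h [Gh ->]]]]].
  apply/asboolP; exists 0%N, (fun=> 0), (fun=> 0); split; first by case.
  by rewrite big_ord0.
apply/asboolP; exists (n + m)%N,
  (fun k => match split k with inl i => a * c i | inr j => d j end),
  (fun k => match split k with inl i => g i | inr j => h j end).
split=> [k|]; first by case: (split k).
rewrite big_split_ord mulr_sumr /=; congr (_ + _); apply: eq_bigr => i _.
  by rewrite (unsplitK (inl i)) mulrA.
by rewrite (unsplitK (inr i)).
Qed.

Lemma ideal_gen_mem (G : set A) x : G x -> x \in ideal_gen G.
Proof.
move=> Gx; apply/asboolP; exists 1%N, (fun=> 1), (fun=> x); split=> //.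
by rewrite big_ord1 mul1r.
Qed.

Lemma ideal_gen_min (G : set A) I x :
  weak_ideal I -> (forall y, G y -> I y) -> x \in ideal_gen G -> I x.
Proof.
by move=> wI GI /asboolP[n [c [g [Gg ->]]]]; apply: weak_ideal_sum => // i; apply: GI.
Qed.

Lemma ideal_gen_range n (g : 'I_n -> A) x :
  x \in ideal_gen (range g) -> exists c : 'I_n -> A, x = \sum_(i < n) c i * g i.
Proof.
pose I x := exists c : 'I_n -> A, x = \sum_(i < n) c i * g i.
apply: (@ideal_gen_min _ I) => [|y [i _ <-]].
  split; first by exists (fun=> 0); rewrite big1 // => i _; rewrite mul0r.
  move=> a u v [c ->] [d ->]; exists (fun i => a * c i + d i).
  by rewrite mulr_sumr -big_split; apply: eq_bigr => i _ /=; rewrite mulrDl mulrA.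
exists (fun j => (j == i)%:R); rewrite (bigD1 i) //= eqxx mul1r big1 ?addr0 // => j /negPf->.
by rewrite mul0r.
Qed.

Lemma idealr_closed_weak (I : {pred A}) :
  idealr_closed I -> weak_ideal (fun x => x \in I).
Proof. by move=> [I0 _ IM]; split=> // a x y; apply: IM. Qed.

Definition fg_ring : Prop := forall I, weak_ideal I -> fg_ideal I.

Lemma fg_noetherian : fg_ring -> noetherian A.
Proof.
move=> fgA I /idealr_closed_weak wI; have [l [lI Il]] := fgA _ wI.
exists (size l), (fun i => l`_i) => x; apply/idP/idP => [/Il|].
  apply: (span_min (ideal_gen_weak _)) => y /(nthP 0)[i ltil <-].
  by apply: ideal_gen_mem; exists (Ordinal ltil).
apply: (ideal_gen_min wI) => y [i _ <-]; exact/lI/mem_nth.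
Qed.

End Span.

Lemma span_rmorph (A B : comNzRingType) (f : {rmorphism A -> B}) l x :
  span l x -> span (map f l) (f x).
Proof.
elim: l x => [|g l IH] x /=; first by move=> ->; rewrite rmorph0.
by move=> [a /IH]; exists (f a); rewrite -rmorphM -rmorphB.
Qed.

Lemma fg_ring_surj (A B : comNzRingType) (f : {rmorphism A -> B}) :
  (forall b, exists a, f a = b) -> fg_ring A -> fg_ring B.
Proof.
move=> surj fgA I wI.
have [|l [lI Il]] := fgA (fun a => I (f a)).
  split=> [|a x y]; first by rewrite rmorph0; case: wI.
  by rewrite rmorphD rmorphM; case: wI => _; apply.
exists (map f l); split=> [_ /mapP[a al ->]|b]; first exact: lI.
by case: (surj b) => a <- /Il; apply: span_rmorph.
Qed.

Lemma fg_ring_field (K : fieldType) : fg_ring K.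
Proof.
move=> I wI; have [[x x0 Ix]|I0] := pselect (exists2 x, x != 0 & I x).
  exists [:: x]; split=> [y|y _ /=]; first by rewrite inE => /eqP->.
  by exists (y / x); rewrite mulfVK // subrr.
exists [::]; split=> // x Ix /=; apply/eqP/negPn/negP => x0.
by apply: I0; exists x.
Qed.

(** Hilbert's basis theorem. The ideals [L d] of coefficients at degree d of elements of I of degree
    at most d increase with d and stabilise at some D. Lifts to I of generators of [L d], for all d
    up to D, generate I, because they can cancel the top coefficient of any element. *)
Lemma fg_ring_poly (A : comNzRingType) : fg_ring A -> fg_ring {poly A}.
Proof.
move=> fgA I wI.
pose L d (a : A) := exists f : {poly A}, [/\ I f, (size f <= d.+1)%N & f`_d = a].
have wL d : weak_ideal (L d).
  split; first by exists 0; rewrite size_poly0 coef0; split=> //; case: wI.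
  move=> a x y [f [If sf <-]] [g [Ig sg <-]]; exists (a%:P * f + g); split.
  - exact: (proj2 wI).
  - rewrite (leq_trans (size_polyD _ _)) // geq_max sg andbT mul_polyC.
    exact: leq_trans (size_scale_leq _ _) sf.
  - by rewrite coefD coefCM.
have Lmono d e a : (d <= e)%N -> L d a -> L e a.
  move=> de [f [If sf <-]]; exists ('X^(e - d) * f); split.
  - exact: weak_idealM.
  - by rewrite (leq_trans (size_polyMleq _ _)) // size_polyXn; lia.
  - by rewrite coefXnM ltnNge leq_subr /= subKn.
have gensP d : exists l : seq {poly A},
    (forall f, f \in l -> I f /\ (size f <= d.+1)%N) /\
    forall a, L d a -> span (map (fun f : {poly A} => f`_d) l) a.
  have [l [lL Ll]] := fgA _ (wL d).
  suff [s [sI sl]] : exists s : seq {poly A},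
      (forall f, f \in s -> I f /\ (size f <= d.+1)%N) /\ map (fun f : {poly A} => f`_d) s = l.
    by exists s; rewrite sl.
  elim: l lL {Ll} => [|a l IH] lL; first by exists [::].
  have [|s [sI sl]] := IH; first by move=> x xl; apply: lL; rewrite inE xl orbT.
  have [f [If sf fa]] := lL a (mem_head _ _).
  exists (f :: s); rewrite /= fa sl; split=> // g; rewrite inE => /orP[/eqP->//|].
  exact: sI.
have {gensP} [gens gensP] := choice gensP.
(* The union of the increasing ideals [L d] is an ideal, and its finitely many generators all occur
   in a single [L D]. *)
have [D LD] : exists D, forall d a, L d a -> L D a.
  have [|l [lL Ll]] := fgA (fun a => exists d, L d a).
    split=> [|a x y [d Lx] [e Ly]]; first by exists 0%N; case: (wL 0%N).
    exists (maxn d e); apply: (proj2 (wL _)).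
      by apply: Lmono Lx; rewrite leq_maxl.
    by apply: Lmono Ly; rewrite leq_maxr.
  have [D lD] : exists D, forall a, a \in l -> L D a.
    elim: l lL {Ll} => [|a l IH] lL; first by exists 0%N.
    have [|D HD] := IH; first by move=> x xl; apply: lL; rewrite inE xl orbT.
    have [d Ld] := lL a (mem_head _ _).
    exists (maxn d D) => x; rewrite inE => /orP[/eqP->|/HD].
      by apply: Lmono Ld; rewrite leq_maxl.
    by apply: Lmono; rewrite leq_maxr.
  by exists D => d a La; apply: (span_min (wL D) lD); apply: Ll; exists d.
pose G := flatten [seq gens d | d <- iota 0 D.+1].
have genG d f : (d <= D)%N -> f \in gens d -> f \in G.
  by move=> dD fd; apply/flattenP; exists (gens d) => //; rewrite map_f // mem_iota.
exists G; split=> [f /flattenP[l /mapP[d _ ->]]|f].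
  by case: (gensP d) => gI _ /gI[].
have wG := span_weak_ideal G.
move: {2}(size f) (leqnn (size f)) => n; elim: n f => [|n IH] f.
  by rewrite leqn0 size_poly_eq0 => /eqP-> _; case: wG.
(* The coefficient of f at n lies in [L d]; beyond D, generators of degree at most D are shifted up
   by a power of X. *)
move=> sf If; pose d := minn n D.
have Lf : L d f`_n.
  rewrite /d; case: (leqP n D) => [nD|/ltnW Dn]; first by exists f.
  by apply: (LD n); exists f.
have [gI gL] := gensP d.
(* A linear combination of coefficients lifts to a combination h of the generators with prescribed
   coefficient at n; then f - h has smaller size. *)
have sub (s : seq {poly A}) a : (forall g, g \in s -> g \in gens d) ->
    span (map (fun f : {poly A} => f`_d) s) a ->
    exists h : {poly A}, [/\ span G h, I h, (size h <= n.+1)%N & h`_n = a].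
  elim: s a => [|g s IHs] a ss /=.
    move=> ->; exists 0; rewrite coef0 size_poly0; split=> //; first by case: wG.
    by case: wI.
  move=> [b /IHs[|h [Gh Ih sh hn]]]; first by move=> x xs; apply: ss; rewrite inE xs orbT.
  have gd : g \in gens d by apply: ss; rewrite mem_head.
  have [Ig sg] := gI _ gd.
  have dn : (d <= n)%N by rewrite geq_minl.
  exists ((b *: 'X^(n - d)) * g + h); split.
  - apply: (proj2 wG) => //; apply/span_mem/genG/gd; exact: geq_minr.
  - exact: (proj2 wI).
  - rewrite (leq_trans (size_polyD _ _)) // geq_max sh andbT.
    rewrite -scalerAl (leq_trans (size_scale_leq _ _)) //.
    by rewrite (leq_trans (size_polyMleq _ _)) // size_polyXn; lia.
  - by rewrite coefD -scalerAl coefZ coefXnM ltnNge leq_subr /= subKn // hn addrC subrK.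
have [h [Gh Ih sh hn]] := sub _ _ (fun _ x => x) (gL _ Lf).
rewrite -[f](subrK h); apply: (weak_idealD wG) => //; apply: IH; last exact: weak_idealB.
apply/leq_sizeP => j; rewrite leq_eqVlt => /orP[/eqP<-|nj].
  by rewrite coefB hn subrr.
by rewrite coefB !nth_default ?subrr // (leq_trans _ nj).
Qed.

(** * Prime spectra and localizations *)

Section Spec.
Variable A : comNzRingType.
Implicit Types (Q : Spec A) (a b x y : A).

Lemma spec_weak Q : weak_ideal (fun x => x \in Q).
Proof. exact: idealr_closed_weak (proj1 (prime_funP Q)). Qed.

Lemma spec0 Q : 0 \in Q.
Proof. by case: (spec_weak Q). Qed.

Lemma spec1 Q : 1 \notin Q.
Proof. exact: Localization.notin_prime1. Qed.

Lemma specM Q a b : (a * b \in Q) = (a \in Q) || (b \in Q).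
Proof.
apply/idP/idP => [/(proj2 (prime_funP Q))//|/orP[aQ|bQ]].
  by rewrite mulrC (weak_idealM _ (spec_weak Q)).
exact: weak_idealM (spec_weak Q) bQ.
Qed.

Lemma specX Q a n : a ^+ n \in Q -> a \in Q.
Proof.
elim: n => [|n IH]; first by rewrite expr0 (negPf (spec1 Q)).
by rewrite exprS specM => /orP[].
Qed.

Lemma specP (S : {pred A}) : weak_ideal (fun x => x \in S) -> 1 \notin S ->
  (forall a b, a * b \in S -> (a \in S) || (b \in S)) -> prime_ideal S.
Proof. by move=> [S0 SM] S1 Sp; split=> //; split=> // a x y; apply: SM. Qed.

Lemma spec_ext Q Q' : Q =i Q' -> Q = Q'.
Proof.
case: Q Q' => [q qP] [r rP] /= eqr; have {}eqr : q = r by apply/funext => x; apply: eqr.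
by move: rP; rewrite -eqr => rP; congr MkSpec; apply: Prop_irrelevance.
Qed.

Definition spec_lt Q Q' := {subset Q <= Q'} /\ exists2 x, x \in Q' & x \notin Q.

Definition spec_chain (c : nat -> Spec A) n := forall i, (i < n)%N -> spec_lt (c i) (c i.+1).

Lemma spec_chain_sub c n i j :
  spec_chain c n -> (i <= j <= n)%N -> {subset c i <= c j}.
Proof.
move=> cc /andP[ij jn]; elim: j ij jn => [|j IH]; first by rewrite leqn0 => /eqP-> _ x.
rewrite leq_eqVlt => /orP[/eqP-> _ x//|ij] jn x /(IH ij (ltnW jn)); exact: (proj1 (cc j jn)).
Qed.

Lemma has_chain_spec n :
  has_chain (range (fun Q => [set x | x \in Q])%classic) n <->
  exists c, spec_chain c n.
Proof.
split=> [[c [cF cS]]|[c cc]].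
  have /choice[d dP] i : exists Q, (i <= n)%N -> [set x | x \in Q]%classic = c i.
    have [le_in|] := leqP i n; last by have [Q _ _] := cF 0%N isT; exists Q.
    by have [Q _ <-] := cF i le_in; exists Q.
  exists d => i ltin; have := cS i ltin.
  rewrite -!dP // 1?ltnW // => -[sub /existsNP[x /not_implyP[xQ' xQ]]].
  split=> //; exists x => //; exact/negP.
exists (fun i => [set x | x \in c i]%classic); split=> [i _|i ltin]; first by exists (c i).
by have [sub [x xQ' xQ]] := cc i ltin; split=> // /(_ x xQ') /=; rewrite (negPf xQ).
Qed.

End Spec.

Lemma comap_prime (A B : comNzRingType) (f : {rmorphism A -> B}) (c : Spec B) :
  prime_ideal (fun a => f a \in c).
Proof.
pose S : {pred A} := fun a => f a \in c.
have SE a : (a \in S) = (f a \in c) by [].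
rewrite -/S; apply: specP => [||a b]; rewrite ?SE ?rmorph1 ?rmorphM ?spec1 ?specM //.
split=> [|a x y]; rewrite !SE; first by rewrite rmorph0 spec0.
by rewrite rmorphD rmorphM; case: (spec_weak c) => _; apply.
Qed.

Definition comap (A B : comNzRingType) (f : {rmorphism A -> B}) (c : Spec B) : Spec A :=
  MkSpec (comap_prime f c).

Lemma comapE (A B : comNzRingType) (f : {rmorphism A -> B}) c a :
  (a \in comap f c) = (f a \in c).
Proof. by []. Qed.

Lemma zero_spec (A : comNzRingType) : (forall x y : A, x * y = 0 -> x = 0 \/ y = 0) ->
  exists Z : Spec A, forall x, (x \in Z) = (x == 0).
Proof.
move=> dom; pose S : {pred A} := pred1 0.
have SP : prime_ideal S.
  apply: specP => [||a b]; rewrite ?inE ?oner_neq0 //.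
    split=> [|a x y]; rewrite !inE ?eqxx // => /eqP-> /eqP->.
    by rewrite mulr0 addr0.
  by move=> /eqP/dom[->|->]; rewrite eqxx ?orbT.
by exists (MkSpec SP).
Qed.

(* [f] induces an isomorphism from the localization of [A] at [Q] to the ring of
   fractions of [B] with denominators in the image of the complement of [Q]. *)
Section FractionExtension.
Variables (A B : comNzRingType) (f : {rmorphism A -> B}) (Q : Spec A).
Hypothesis frac : forall x : B, exists a s, s \notin Q /\ f s * x = f a.
Hypothesis frac_eq : forall a b, f a = f b -> exists2 s, s \notin Q & s * a = s * b.

Definition frac_ext (c : Spec A) : {pred B} := fun x =>
  `[< exists a s, [/\ a \in c, s \notin Q & f s * x = f a] >].

Lemma frac_ext_weak c : weak_ideal (fun x => x \in frac_ext c).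
Proof.
split=> [|z x y /asboolP[a [s [ac sQ e]]] /asboolP[b [t [bc tQ g]]]].
  apply/asboolP; exists 0, 1; rewrite spec0 spec1; split=> //.
  by rewrite rmorph0 mulr0.
have [d [r [rQ k]]] := frac z; apply/asboolP.
exists (d * a * t + b * (r * s)), (r * s * t); rewrite !specM !negb_or sQ tQ rQ; split=> //.
  by apply: (weak_idealD (spec_weak c)); rewrite !specM ?ac ?bc ?orbT.
rewrite rmorphD !rmorphM /= -e -g -k; ring.
Qed.

(** Clearing denominators costs only factors outside Q, hence outside c, and these cancel because c
    is prime. *)
Lemma frac_extE (c : Spec A) a : {subset c <= Q} -> (f a \in frac_ext c) = (a \in c).
Proof.
move=> cQ; apply/asboolP/idP => [[b [s [bc sQ]]]|ac]; last first.
  by exists a, 1; rewrite spec1 rmorph1 mul1r.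
rewrite -rmorphM => /frac_eq[t tQ e].
have : t * (s * a) \in c by rewrite e specM bc orbT.
by rewrite !specM => /or3P[/cQ|/cQ|//]; rewrite ?(negPf tQ) ?(negPf sQ).
Qed.

Lemma frac_ext_prime (c : Spec A) : {subset c <= Q} -> prime_ideal (frac_ext c).
Proof.
move=> cQ; apply: specP; first exact: frac_ext_weak.
  by rewrite -(rmorph1 f) frac_extE // spec1.
move=> x y xy; have [a [s [sQ e]]] := frac x; have [b [t [tQ g]]] := frac y.
have : f (a * b) \in frac_ext c.
  have -> : f (a * b) = f (s * t) * (x * y).
    by rewrite !rmorphM /= -e -g; ring.
  exact: weak_idealM (frac_ext_weak c) xy.
rewrite frac_extE // specM => /orP[ac|bc]; apply/orP; [left|right]; apply/asboolP.
  by exists a, s.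
by exists b, t.
Qed.

Lemma frac_ext_chain n (c : nat -> Spec A) : spec_chain c n -> {subset c n <= Q} ->
  exists d : nat -> Spec B, spec_chain d n /\
    forall i, (i <= n)%N -> d i =i frac_ext (c i).
Proof.
move=> cc cQ; have sub i : (i <= n)%N -> {subset c i <= Q}.
  by move=> ltin a /(spec_chain_sub cc) ac; apply/cQ/ac; rewrite ltin leqnn.
(* Beyond n the sequence takes an arbitrary prime, here the extension of [c 0]. *)
have /choice[d dP] i : exists d : Spec B, (i <= n)%N -> d =i frac_ext (c i).
  have [/sub le_in|_] := leqP i n; last first.
    by exists (MkSpec (frac_ext_prime (sub 0%N (leq0n n)))).
  by exists (MkSpec (frac_ext_prime le_in)).
exists d; split=> // i ltin; have [s [a ac anc]] := cc i ltin; split=> [x|].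
  rewrite !dP // 1?ltnW // => /asboolP[b [t [bc tQ e]]].
  by apply/asboolP; exists b, t; split=> //; apply: s.
exists (f a); rewrite dP // 1?ltnW // frac_extE //; apply: sub => //.
exact: ltnW.
Qed.

End FractionExtension.

(** * The localization at a prime: chains, maximal ideal and generators *)

Section LocalizationTheory.
Variables (A : comNzRingType) (Q : Spec A).
Local Notation loc := (Localization.loc Q).
Local Open Scope quotient_scope.

Definition to_loc (a : A) : loc := \pi_loc (Localization.mkfrac a (Localization.notin_prime1 Q)).

Fact to_loc_zmod_morphism : zmod_morphism to_loc.
Proof.
move=> a b; change (to_loc (a - b) = Localization.add (to_loc a) (Localization.opp (to_loc b))).
rewrite /to_loc -Localization.pi_opp -Localization.pi_add.
by apply: Localization.eq_loc; rewrite !Localization.fracE; ring.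
Qed.

Fact to_loc_monoid_morphism : monoid_morphism to_loc.
Proof.
split=> [|a b]; first by change (to_loc 1 = Localization.one Q); unlock Localization.one.
change (to_loc (a * b) = Localization.mul (to_loc a) (to_loc b)).
rewrite /to_loc -Localization.pi_mul.
by apply: Localization.eq_loc; rewrite !Localization.fracE; ring.
Qed.

HB.instance Definition _ := GRing.isZmodMorphism.Build A loc to_loc to_loc_zmod_morphism.
HB.instance Definition _ := GRing.isMonoidMorphism.Build A loc to_loc to_loc_monoid_morphism.

Lemma loc_frac (x : loc) : exists a s, s \notin Q /\ to_loc s * x = to_loc a.
Proof.
rewrite -[x]reprK; case: (repr x) => [[a s] /= sQ]; exists a, s; split=> //.
change (Localization.mul (to_loc s) (\pi_loc (Localization.mkfrac a sQ)) = to_loc a).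
rewrite /to_loc -Localization.pi_mul; apply: Localization.eq_loc.
by rewrite !Localization.fracE; ring.
Qed.

Lemma loc_unit s : s \notin Q -> exists y : loc, y * to_loc s = 1.
Proof.
move=> sQ; exists (\pi_loc (Localization.mkfrac 1 sQ)).
change (Localization.mul (\pi_loc (Localization.mkfrac 1 sQ)) (to_loc s) = 1).
rewrite -to_loc_monoid_morphism.1 /to_loc -Localization.pi_mul; apply: Localization.eq_loc.
by rewrite !Localization.fracE; ring.
Qed.

Lemma to_loc_eq0 a : to_loc a = 0 -> exists2 s, s \notin Q & s * a = 0.
Proof.
rewrite -(rmorph0 to_loc) => /eqP /Localization.eq_locP[s sQ].
by rewrite !Localization.fracE mulr1 mul0r subr0; exists s.
Qed.

Lemma to_loc_eq a b : to_loc a = to_loc b -> exists2 s, s \notin Q & s * a = s * b.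
Proof.
move=> e; have [|s sQ] := @to_loc_eq0 (a - b); first by rewrite rmorphB /= e subrr.
by move=> /eqP; rewrite mulrBr subr_eq0 => /eqP; exists s.
Qed.

Lemma fg_ring_loc : fg_ring A -> fg_ring loc.
Proof.
move=> fgA I wI; have [|l [lI Il]] := fgA (fun a => I (to_loc a)).
  split=> [|a x y]; first by rewrite rmorph0; case: wI.
  by rewrite rmorphD rmorphM; case: wI => _; apply.
exists (map to_loc l); split=> [_ /mapP[a al ->]|x Ix]; first exact: lI.
have [a [s [sQ e]]] := loc_frac x; have [y ys] := loc_unit sQ.
rewrite -[x]mul1r -ys -mulrA e; apply: weak_idealM; first exact: span_weak_ideal.
by apply/span_rmorph/Il; rewrite -e; apply: weak_idealM.
Qed.

Local Notation loc_ext := (frac_ext to_loc Q).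

Lemma comap_to_loc_sub c : {subset comap to_loc c <= Q}.
Proof.
move=> a; rewrite comapE => ac; apply/negPn/negP => /loc_unit[y ya].
by have := spec1 c; rewrite -ya specM ac orbT.
Qed.

Lemma loc_mem_num (c : Spec loc) x a s :
  s \notin Q -> to_loc s * x = to_loc a -> (x \in c) = (to_loc a \in c).
Proof.
by move=> sQ <-; rewrite specM; have /negPf-> : to_loc s \notin c
  by apply: contra sQ => sc; apply: (@comap_to_loc_sub c).
Qed.

(** Primes of the localization correspond to primes inside Q. Strictness survives contraction
    because an element and its numerator lie in the same primes. *)
Lemma chain_comap_to_loc n :
  (exists c : nat -> Spec loc, spec_chain c n) <->
  exists c : nat -> Spec A, spec_chain c n /\ {subset c n <= Q}.
Proof.
split=> [[c cc]|[c [cc cQ]]].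
  exists (fun i => comap to_loc (c i)); split; last exact: comap_to_loc_sub.
  move=> i /cc[sub [x xc xnc]]; split=> [a|]; first by rewrite !comapE => /sub.
  have [a [s [sQ e]]] := loc_frac x; exists a.
    by rewrite comapE -(loc_mem_num _ sQ e).
  by rewrite comapE -(loc_mem_num _ sQ e).
by have [d [dc _]] := frac_ext_chain loc_frac to_loc_eq cc cQ; exists d.
Qed.

(** The g i generate the maximal ideal of the localization at Q, expressed inside A by clearing
    denominators. *)
Definition local_gens n (g : 'I_n -> A) :=
  (forall i, g i \in Q) /\
  forall f, f \in Q -> exists2 s, s \notin Q &
    exists c : 'I_n -> A, s * f = \sum_(i < n) c i * g i.

Lemma locQ_mem x a s : s \notin Q -> to_loc s * x = to_loc a ->
  (x \in loc_ext Q) = (a \in Q).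
Proof.
move=> sQ e; rewrite -(@frac_extE _ _ _ _ to_loc_eq Q a) //= -e.
have ex : prime_ideal (loc_ext Q) by exact: (frac_ext_prime loc_frac to_loc_eq).
change ((x \in MkSpec ex) = (to_loc s * x \in MkSpec ex)); rewrite specM.
suff /negPf-> : to_loc s \notin MkSpec ex by [].
by rewrite [_ \in _](frac_extE to_loc_eq).
Qed.

Lemma loc_unitP x : x \notin loc_ext Q -> exists y : loc, y * x = 1.
Proof.
have [a [s [sQ e]]] := loc_frac x; rewrite (locQ_mem sQ e) => /loc_unit[y ya].
by exists (y * to_loc s); rewrite -mulrA e.
Qed.

Lemma ideal_sub_locQ (J : {pred loc}) : idealr_closed J -> {subset J <= loc_ext Q}.
Proof.
move=> iJ x xJ; apply/negPn/negP => /loc_unitP[y yx].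
have [_ /negP J1 _] := iJ; apply: J1; rewrite -yx.
exact: weak_idealM (idealr_closed_weak iJ) xJ.
Qed.

Lemma locQ_closed : idealr_closed (loc_ext Q).
Proof. by case: (@frac_ext_prime _ _ _ _ loc_frac to_loc_eq Q (fun _ x => x)). Qed.

Lemma locQ_max : maximal_ideal (loc_ext Q).
Proof.
split=> [|J iJ sub x]; first exact: locQ_closed.
by apply/idP/idP => [/(ideal_sub_locQ iJ)|/sub].
Qed.

Lemma locQ_local : local_with_max (loc_ext Q).
Proof.
split=> [|M [iM maxM] x]; first exact: locQ_max.
by rewrite (maxM (loc_ext Q)) //; [exact: locQ_closed | exact: ideal_sub_locQ].
Qed.

Lemma local_gens_ext n (g : 'I_n -> A) :
  local_gens g -> loc_ext Q =i ideal_gen (range (to_loc \o g)).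
Proof.
move=> [gQ gen] x; apply/idP/idP => [/asboolP[a [s [aQ sQ e]]]|].
  have [t tQ [c ec]] := gen a aQ.
  have [y yst] : exists y, y * to_loc (t * s) = 1.
    by apply: loc_unit; rewrite specM negb_or tQ.
  have -> : x = \sum_(i < n) (y * to_loc (c i)) * to_loc (g i).
    under eq_bigr do rewrite -mulrA -rmorphM.
    rewrite -mulr_sumr -rmorph_sum -ec rmorphM /= -e -[LHS]mul1r -yst rmorphM /=; ring.
  apply: (weak_ideal_sum _ (ideal_gen_weak _)) => i.
  by apply: ideal_gen_mem; exists i.
apply: (ideal_gen_min (frac_ext_weak loc_frac Q)) => y [i _ <-] /=.
by rewrite (frac_extE to_loc_eq).
Qed.

Lemma local_gens_of_ext n (g : 'I_n -> loc) :
  loc_ext Q =i ideal_gen (range g) -> exists g' : 'I_n -> A, local_gens g'.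
Proof.
move=> gen.
have /choice[g' /choice[s gs]] i : exists a s, s \notin Q /\ to_loc s * g i = to_loc a.
  exact: loc_frac.
have gQ i : g' i \in Q.
  have [sQ e] := gs i; rewrite -(locQ_mem sQ e) gen; apply: ideal_gen_mem.
  by exists i.
exists g'; split=> // f fQ.
have : to_loc f \in ideal_gen (range g) by rewrite -gen (frac_extE to_loc_eq).
move=> /ideal_gen_range[c ec].
have /choice[y yP] i : exists y, y * to_loc (s i) = 1.
  by apply: loc_unit; case: (gs i).
have /choice[a /choice[t at_]] i : exists a t, t \notin Q /\ to_loc t * (c i * y i) = to_loc a.
  exact: loc_frac.
(* A common denominator of all the coefficients. *)
pose T := \prod_(i < n) t i.
have TQ : T \notin Q.
  rewrite /T; elim/big_ind: _ => [|u v uQ vQ|i _]; first exact: spec1.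
    by rewrite specM negb_or uQ.
  by case: (at_ i).
have : to_loc (T * f) = to_loc (\sum_(i < n) (a i * \prod_(j < n | j != i) t j) * g' i).
  rewrite rmorphM rmorph_sum /= ec mulr_sumr; apply: eq_bigr => i _.
  have [_ e] := gs i; have [_ e'] := at_ i.
  rewrite /T (bigD1 i) //= !rmorphM /= -e -e'.
  rewrite -[c i * g i]mul1r -(yP i); ring.
(* [to_loc] need not be injective, so the identity holds in A only after multiplication by some r
   outside Q. *)
move=> /to_loc_eq[r rQ e]; exists (r * T); first by rewrite specM negb_or rQ.
exists (fun i => r * (a i * \prod_(j < n | j != i) t j)).
by rewrite -mulrA e mulr_sumr; apply: eq_bigr => i _; rewrite mulrA.
Qed.

Lemma regular_localization n (c : nat -> Spec A) (g : 'I_n -> A) :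
  fg_ring A -> spec_chain c n -> c n =i Q -> local_gens g ->
  (forall m c', spec_chain c' m -> {subset c' m <= Q} -> (m <= n)%N) ->
  regular_local_ring (localization Q).
Proof.
move=> fgA cc cQ gens bound; split; first exact/fg_noetherian/fg_ring_loc.
exists (loc_ext Q), n; split; first exact: locQ_local.
  split=> [|m]; rewrite has_chain_spec chain_comap_to_loc.
    by exists c; split=> // x; rewrite cQ.
  by move=> [c' [cc' c'Q]]; apply: bound cc' c'Q.
by exists (to_loc \o g); apply: local_gens_ext.
Qed.

Lemma regular_localization_inv :
  regular_local_ring (localization Q) ->
  exists n (c : nat -> Spec A) (g : 'I_n -> A),
    [/\ spec_chain c n, {subset c n <= Q} & local_gens g].
Proof.
move=> [_ [M [n [[_ Mu] [hc _] [g gM]]]]].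
move: hc; rewrite has_chain_spec chain_comap_to_loc => -[c [cc cQ]].
have [|g' g'P] := @local_gens_of_ext n g.
  by move=> x; rewrite (Mu _ locQ_max) gM.
by exists n, c, g'.
Qed.

End LocalizationTheory.

(** * Algebraic independence and chains of primes *)

Section IteratedPoly.
Variable K : fieldType.

(** The polynomial ring in n variables as an iterated univariate one, so that statements are proved
    one variable at a time. *)
Fixpoint iterpoly (n : nat) : idomainType :=
  if n is m.+1 then {poly (iterpoly m)} else K.

Fixpoint iconst n : {rmorphism K -> iterpoly n} :=
  if n is m.+1 then (@polyC (iterpoly m)) \o (iconst m) else idfun.

Fixpoint ivar n : nat -> iterpoly n :=
  if n is m.+1 then fun i => if i == m then 'X else (ivar m i)%:P else fun=> 0.

Section Eval.
Variables (A : comNzRingType) (iota : {rmorphism K -> A}).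

Fixpoint ieval (s : nat -> A) n : {rmorphism iterpoly n -> A} :=
  if n is m.+1 then horner_morph (fun x => mulrC (s m) (ieval s m x)) else iota.

Lemma ievalS s n (p : iterpoly n.+1) :
  ieval s n.+1 p = (map_poly (ieval s n) (p : {poly iterpoly n})).[s n].
Proof. by []. Qed.

Lemma ievalC s n (a : iterpoly n) : ieval s n.+1 (a%:P : {poly iterpoly n}) = ieval s n a.
Proof. exact: horner_morphC. Qed.

Lemma ievalX s n : ieval s n.+1 ('X : {poly iterpoly n}) = s n.
Proof. exact: horner_morphX. Qed.

Lemma ieval_const s n k : ieval s n (iconst n k) = iota k.
Proof. by elim: n => [|n IH] //; rewrite -IH; exact: ievalC. Qed.

Lemma ieval_var s n i : (i < n)%N -> ieval s n (ivar n i) = s i.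
Proof.
elim: n => [|n IH] //; rewrite ltnS leq_eqVlt /= => /orP[/eqP->|lt_in].
  by rewrite eqxx; exact: ievalX.
rewrite ltn_eqF // -[RHS]IH //; exact: ievalC.
Qed.

Lemma eq_ieval s s' n (p : iterpoly n) :
  (forall i, (i < n)%N -> s i = s' i) -> ieval s n p = ieval s' n p.
Proof.
elim: n p => [|n IH] p // ss'; rewrite !ievalS ss' //; congr horner.
by apply: eq_map_poly => a; apply: IH => i /ltnW; exact: ss'.
Qed.

(** Algebraic independence over K, modulo Q, of the first n terms of s. *)
Definition indep (Q : {pred A}) (s : nat -> A) n : Prop :=
  forall p, ieval s n p \in Q -> p = 0.

Lemma indep_sub (Q Q' : {pred A}) s n : {subset Q <= Q'} -> indep Q' s n -> indep Q s n.
Proof. by move=> sub ind p /sub/ind. Qed.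

(** View a relation modulo Q as a polynomial in f. Modulo Q' only its constant term survives, so
    that term is zero by independence; then f, which is outside the prime Q, can be divided out, and
    induction on the degree in f concludes. *)
Lemma indep_step (Q Q' : Spec A) s n f : {subset Q <= Q'} -> f \in Q' -> f \notin Q ->
  indep Q' s n -> indep Q (fun i => if (i < n)%N then s i else f) n.+1.
Proof.
move=> sub fQ' fQ ind p; rewrite ievalS ltnn.
have -> : map_poly (ieval (fun i => if (i < n)%N then s i else f) n) p = map_poly (ieval s n) p.
  by apply: eq_map_poly => a; apply: eq_ieval => i ->.
elim/poly_ind: (p : {poly iterpoly n}) => {p} // p a IH.
rewrite rmorphD rmorphM /= map_polyX map_polyC /= hornerMXaddC => eQ.
have a0 : a = 0.
  apply: ind; rewrite -[ieval s n a](addKr ((map_poly (ieval s n) p).[f] * f)) addrC.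
  by apply: (weak_idealB (spec_weak Q')); [exact: sub | rewrite specM fQ' orbT].
move: eQ; rewrite a0 rmorph0 !addr0 specM (negPf fQ) orbF => /IH->.
by rewrite mul0r.
Qed.

Lemma indep_chain (c : nat -> Spec A) m s n : spec_chain c m -> indep (c m) s n ->
  exists s', indep (c 0%N) s' (m + n).
Proof.
elim: m c => [|m IH] c cc ind; first by exists s.
have [|//|s' ind'] := IH (fun i => c i.+1); first by move=> i; exact: (cc i.+1).
have [sub [f fc1 fc0]] := cc 0%N isT.
exists (fun i => if (i < m + n)%N then s' i else f); exact: indep_step sub fc1 fc0 ind'.
Qed.

End Eval.

(** * Polynomials of bounded degree in each variable *)

Section Box.
Implicit Types d e n : nat.

(** Degree at most d in each of the n variables separately: a space of dimension (d+1)^n over K. *)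
Fixpoint box d n : iterpoly n -> Prop :=
  if n is m.+1 then fun p : {poly iterpoly m} => (size p <= d.+1)%N /\ forall i, box d p`_i
  else fun=> True.

Lemma box0 d n : box d (0 : iterpoly n).
Proof. by elim: n => [|n IH] //=; rewrite size_poly0; split=> // i; rewrite coef0. Qed.

Lemma boxD d n (p q : iterpoly n) : box d p -> box d q -> box d (p + q).
Proof.
elim: n p q => [|n IH] //= p q [sp bp] [sq bq]; split=> [|i].
  by rewrite (leq_trans (size_polyD _ _)) // geq_max sp.
by rewrite coefD; apply: IH.
Qed.

Lemma boxM d e n (p q : iterpoly n) : box d p -> box e q -> box (d + e) (p * q).
Proof.
elim: n p q => [|n IH] //= p q [sp bp] [sq bq]; split=> [|i].
  apply: leq_trans (size_polyMleq _ _) _; move: (size p) (size q) sp sq => a b; lia.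
rewrite coefM; elim/big_ind: _ => [|x y|j _]; [exact: box0 | exact: boxD | exact: IH].
Qed.

Lemma box1 d n : box d (1 : iterpoly n).
Proof.
elim: n => [|n IH] //=; rewrite size_poly1; split=> // -[|i]; rewrite coef1 //=.
exact: box0.
Qed.

Lemma boxX d k n (p : iterpoly n) : box d p -> box (k * d) (p ^+ k).
Proof.
move=> bp; elim: k => [|k IH]; first exact: box1.
by rewrite exprS mulSn; apply: boxM.
Qed.

Lemma box_mono d e n (p : iterpoly n) : (d <= e)%N -> box d p -> box e p.
Proof.
move=> de; elim: n p => [|n IH] //= p [sp bp]; split=> [|i]; last exact: IH.
exact: leq_trans sp _.
Qed.

Lemma box_seq n (s : seq (iterpoly n)) :
  (forall p : iterpoly n, exists d, box d p) -> exists d, forall i, box d s`_i.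
Proof.
move=> ex; elim: s => [|p s [d IH]]; first by exists 0%N => i; rewrite nth_nil; exact: box0.
have [e bp] := ex p; exists (maxn d e) => -[|i] /=.
  exact: box_mono (leq_maxr _ _) bp.
exact: box_mono (leq_maxl _ _) (IH i).
Qed.

Lemma box_exists n (p : iterpoly n) : exists d, box d p.
Proof.
elim: n p => [|n IH] /= p; first by exists 0%N.
have [d bd] := box_seq p IH; exists (maxn d (size p)); split.
  by rewrite leqW // leq_maxr.
move=> i; exact: box_mono (leq_maxl _ _) (bd i).
Qed.

(** Linear dependence of vectors with r entries from a space of dimension (d+1)^n. Each induction
    step trades one variable for d+1 times as many entries; with no variable left, a matrix with
    more rows than columns has a nonzero left kernel. *)
Lemma box_dependent d n (I : finType) r (P : I -> nat -> iterpoly n) :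
  (forall j i, box d (P j i)) -> (r * d.+1 ^ n < #|I|)%N ->
  exists v : I -> K, (exists j, v j != 0) /\
    forall i, (i < r)%N -> \sum_j iconst n (v j) * P j i = 0.
Proof.
elim: n r P => [|n IH] r P bP ltI.
  rewrite expn0 muln1 in ltI.
  pose M : 'M[K]_(#|I|, r) := \matrix_(a, i) (P (enum_val a) i : K).
  have /rowV0Pn[v /sub_kermxP vM v0] : kermx M != 0.
    rewrite kermx_eq0 /row_free; apply: contraTneq ltI => <-.
    by rewrite -leqNgt rank_leq_col.
  exists (fun j => v 0 (enum_rank j)); split.
    move: v0; rewrite -subr_eq0 subr0; case: (pickP (fun i => v 0 i != 0)) => [i vi _|v0].
      by exists (enum_val i); rewrite enum_valK.
    by case/eqP; apply/rowP => i; rewrite mxE; apply/eqP; rewrite -[_ == _]negbK v0.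
  move=> i ltir; have /rowP/(_ (Ordinal ltir)) := vM; rewrite !mxE => e.
  apply: etrans e.
  change (\sum_j v 0 (enum_rank j) * (P j i : K) = \sum_j v 0 j * M j (Ordinal ltir) :> K).
  rewrite (reindex_onto enum_val enum_rank) /=; last by move=> j _; rewrite enum_rankK.
  apply: eq_big => [a|a _]; first by rewrite enum_valK eqxx.
  by rewrite enum_valK mxE.
(* Coefficient k of the entry i becomes the entry i(d+1)+k. *)
have [j i||v [v0 vP]] := IH (r * d.+1)%N
    (fun j i => (P j (i %/ d.+1)%N : {poly iterpoly n})`_(i %% d.+1)).
- by case: (bP j (i %/ d.+1)%N) => _; apply.
- by rewrite -mulnA -expnS.
exists v; split=> // i ltir; apply/polyP => k; rewrite coef0 coef_sum.
under eq_bigr do rewrite coefCM.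
have [ltkd|ltdk] := ltnP k d.+1; last first.
  rewrite big1 // => j _; rewrite nth_default ?mulr0 //.
  by have [sP _] := bP j i; exact: leq_trans sP ltdk.
have := vP (i * d.+1 + k)%N; rewrite divnMDl // divn_small // addn0 modnMDl modn_small //.
by apply; nia.
Qed.

(** Exponent vectors of length N with entries below D. *)
Fixpoint mono_index (D N : nat) : finType :=
  if N is m.+1 then (mono_index D m * 'I_D)%type else unit.

Lemma card_mono_index D N : #|mono_index D N| = (D ^ N)%N.
Proof. by elim: N => [|N IH] /=; rewrite ?card_unit // card_prod IH card_ord expnSr. Qed.

Fixpoint imono D N : mono_index D N -> iterpoly N :=
  if N is m.+1 then fun j => (imono j.1)%:P * 'X^(j.2) else fun=> 1.

Lemma imono_free D N (v : mono_index D N -> K) :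
  \sum_j iconst N (v j) * imono j = 0 -> forall j, v j = 0.
Proof.
elim: N v => [|N IH] v /=.
  by rewrite (big_pred1 tt) => [|[]//]; rewrite mulr1 => v0 [].
move=> e [j l]; apply: (IH (fun j => v (j, l))).
have /polyP/(_ l) := e; rewrite coef0 coef_sum => {}e; apply: etrans e.
rewrite [RHS](eq_bigr (fun q : mono_index D N * 'I_D =>
  ((iconst N (v (q.1, q.2)))%:P * ((imono q.1)%:P * 'X^(q.2)))`_l)) => [|[]//].
rewrite -(pair_bigA _ (fun j l' => ((iconst N (v (j, l')))%:P * ((imono j)%:P * 'X^l'))`_l)) /=.
apply: eq_bigr => a _; rewrite (bigD1 l) //= big1 ?addr0 => [|l' nl].
  by rewrite coefCM coefCM coefXn eqxx mulr1.
by rewrite coefCM coefCM coefXn (negPf (_ : l != l' :> nat)) ?mulr0 // eq_sym.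
Qed.

End Box.

(** * Bounding the transcendence degree by counting monomials *)

Section Count.
Variables (A : comNzRingType) (iota : {rmorphism K -> A}) (Z : Spec A).
Variables (s : nat -> A) (n : nat).
Local Notation phi := (ieval iota s n).

Lemma common_denominator (t : nat -> A) N :
  (forall i, (i < N)%N -> exists r b, phi r \notin Z /\ phi r * t i = phi b) ->
  exists r (p : nat -> iterpoly n), phi r \notin Z /\
    forall i, (i < N)%N -> phi r * t i = phi (p i).
Proof.
elim: N => [|N IH] gen; first by exists 1, (fun=> 0); rewrite rmorph1 spec1.
have [|r [p [rZ rp]]] := IH; first by move=> i /leqW; exact: gen.
have [r' [b [r'Z e]]] := gen N (leqnn _).
exists (r * r'), (fun i => if (i < N)%N then r' * p i else r * b).
split=> [|i]; first by rewrite rmorphM specM negb_or rZ.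
rewrite ltnS leq_eqVlt => /orP[/eqP->|ltiN]; first by rewrite ltnn !rmorphM -mulrA e.
by rewrite ltiN !rmorphM -(rp i) //; ring.
Qed.

(* The homogenised value of a monomial with exponents below D: substitute p i / r
   and clear denominators by the factor r ^ (N * D). *)
Fixpoint imono_subst (r : iterpoly n) (p : nat -> iterpoly n) D N : mono_index D N -> iterpoly n :=
  if N is m.+1 then fun j => imono_subst r p j.1 * (p m ^+ j.2 * r ^+ (D - j.2)) else fun=> 1.

Lemma box_imono_subst r p e D N (j : mono_index D N) :
  box e r -> (forall i, (i < N)%N -> box e (p i)) -> box (N * (D * e)) (imono_subst r p j).
Proof.
move=> br; elim: N j => [|N IH] /= j bp; first exact: box1.
rewrite mulSnr; apply: boxM; first by apply: IH => i /leqW; exact: bp.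
have -> : (D * e = j.2 * e + (D - j.2) * e)%N by have := ltn_ord j.2; nia.
by apply: boxM; apply: boxX => //; apply: bp.
Qed.

Lemma ieval_imono_subst r p (t : nat -> A) D N (j : mono_index D N) :
  (forall i, (i < N)%N -> phi r * t i = phi (p i)) ->
  phi (imono_subst r p j) = phi r ^+ (N * D) * ieval iota t N (imono j).
Proof.
elim: N j => [|N IH] j rp; first by rewrite /= !rmorph1 mul0n expr0 mulr1.
rewrite [imono_subst _ _ _]/= rmorphM IH => [|i /leqW]; last exact: rp.
rewrite [imono j]/= [in RHS]rmorphM ievalC rmorphXn ievalX !rmorphM !rmorphXn -rp //.
have -> : (N.+1 * D = N * D + (j.2 + (D - j.2)))%N by have := ltn_ord j.2; nia.
by rewrite !exprD exprMn; ring.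
Qed.

(** The D^N monomials in t with exponents below D become, after clearing denominators, polynomials
    in n variables of degree O(D) in each, a space of dimension O(D^n). For N > n and large D they
    are linearly dependent, contradicting independence. *)
Lemma indep_leq (t : nat -> A) N :
  indep iota Z t N ->
  (forall i, (i < N)%N -> exists r b, phi r \notin Z /\ phi r * t i = phi b) ->
  (N <= n)%N.
Proof.
move=> ind /common_denominator[r [p [rZ rp]]].
have [e0 b0] := box_exists r; have [e1 b1] := box_seq (mkseq p N) (@box_exists n).
pose e := maxn e0 e1.
have br : box e r := box_mono (leq_maxl _ _) b0.
have bp i : (i < N)%N -> box e (p i).
  by move=> ltiN; have := b1 i; rewrite nth_mkseq //; apply: box_mono; exact: leq_maxr.
rewrite leqNgt; apply/negP => ltnN.
(* Chosen so that (NDe+1)^n <= D^n (Ne+1)^n < D^(n+1) <= D^N. *)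
pose D := ((N * e).+1 ^ n).+1.
have ltI : (1 * (N * (D * e)).+1 ^ n < #|mono_index D N|)%N.
  rewrite card_mono_index mul1n.
  have le1 : ((N * (D * e)).+1 ^ n <= D ^ n * (N * e).+1 ^ n)%N.
    have leX a b k : (a <= b -> a ^ k <= b ^ k)%N by case: k => // k; rewrite leq_exp2r.
    by rewrite -expnMn; apply: leX; rewrite /D; nia.
  apply: leq_ltn_trans le1 _; apply: (@leq_trans (D ^ n.+1)); last by rewrite leq_pexp2l.
  by rewrite expnSr ltn_pmul2l ?expn_gt0.
have [//|v [[j vj] vP]] := @box_dependent (N * (D * e))%N n _ 1%N
  (fun (j : mono_index D N) _ => imono_subst r p j) _ ltI.
  by move=> j _; apply: box_imono_subst.
case/eqP: vj; apply: (imono_free (v := v)); apply: ind.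
have : phi r ^+ (N * D) * ieval iota t N (\sum_j iconst N (v j) * imono j) \in Z.
  rewrite rmorph_sum mulr_sumr (eq_bigr (fun j => phi (iconst n (v j) * imono_subst r p j))).
    by rewrite -rmorph_sum (vP 0%N) // rmorph0 spec0.
  by move=> i _; rewrite !rmorphM !ieval_const (ieval_imono_subst _ rp); ring.
by rewrite specM => /orP[/specX|//]; rewrite (negPf rZ).
Qed.

End Count.

(* The independence of [t] modulo the top prime measures its residue
   transcendence degree, so this is the inequality
   height + residue transcendence degree <= transcendence degree. *)
Lemma chain_indep_leq (A : comNzRingType) (iota : {rmorphism K -> A}) (s : nat -> A) n
    (c : nat -> Spec A) m (t : nat -> A) k :
  (forall x y : A, x * y = 0 -> x = 0 \/ y = 0) ->
  (forall a, exists r b, ieval iota s n r != 0 /\ ieval iota s n r * a = ieval iota s n b) ->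
  spec_chain c m -> indep iota (c m) t k -> (m + k <= n)%N.
Proof.
move=> dom gen cc ind.
have [Z ZE] := zero_spec dom.
(* The bottom prime is replaced by the zero ideal, so that the elements added along the chain are
   independent in A itself. *)
pose c' i := if i is j.+1 then c i else Z.
have ind' : indep iota (c' m) t k.
  case: m {cc} ind => [|m] //=; apply: indep_sub => x.
  by rewrite ZE => /eqP->; exact: spec0.
have [|t' tP] := indep_chain _ ind'.
  case=> [|i] /cc // [sub [x x1 x0]]; split=> [y|].
    by rewrite ZE => /eqP->; exact: spec0.
  by exists x => //; apply: contra x0; rewrite ZE => /eqP->; exact: spec0.
apply: (indep_leq (s := s) tP) => i _; have [r [b [r0 e]]] := gen (t' i).
by exists r, b; rewrite ZE.
Qed.

End IteratedPoly.

(** * Regularity of polynomial rings *)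

Section RegularData.
Variable K : fieldType.

(* [h] is the height of [Q], and [t] the transcendence degree of its residue field. *)
Definition regular_at (A : comNzRingType) (iota : {rmorphism K -> A}) n (Q : Spec A) : Prop :=
  exists h t (c : nat -> Spec A) (g : 'I_h -> A) (s : nat -> A),
    [/\ (h + t)%N = n, spec_chain c h, c h =i Q, local_gens Q g & indep iota Q s t].

Lemma ieval_rmorph (A B : comNzRingType) (iota : {rmorphism K -> A})
    (iota' : {rmorphism K -> B}) (f : {rmorphism A -> B}) s n p :
  (forall k, f (iota k) = iota' k) ->
  f (ieval iota s n p) = ieval iota' (f \o s) n p.
Proof.
move=> fi; elim: n p => [|n IH] p; first exact: fi.
rewrite !ievalS; elim/poly_ind: (p : {poly (iterpoly K n)}) => {p} [|p a IHp].
  by rewrite !rmorph0 !horner0 rmorph0.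
by rewrite !rmorphD !rmorphM /= !map_polyX !map_polyC /= !hornerMXaddC rmorphD rmorphM IHp IH.
Qed.

Lemma regular_at_field (Q : Spec (iterpoly K 0)) : regular_at (iconst K 0) 0 Q.
Proof.
have Q0 (x : K) : (x : iterpoly K 0) \in Q -> x = 0.
  move=> xQ; apply/eqP/negPn/negP => x0; have := spec1 Q; rewrite -(mulVf x0).
  by rewrite (specM Q) xQ orbT.
exists 0%N, 0%N, (fun=> Q), (fun=> 0), (fun=> 0); split=> //.
split=> [[]//|f fQ]; exists 1; rewrite ?spec1 //; exists (fun=> 0).
by rewrite big_ord0 mul1r; exact: Q0.
Qed.

(** * Primes of a polynomial ring in one variable *)

Section PolyStep.
Variables (B : idomainType) (iota : {rmorphism K -> B}) (n : nat).
Hypothesis regB : forall q : Spec B, regular_at iota n q.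

Definition poly_ext (q : Spec B) : {pred {poly B}} := fun p => `[< forall i, p`_i \in q >].

Lemma poly_extP (q : Spec B) (p : {poly B}) : reflect (forall i, p`_i \in q) (p \in poly_ext q).
Proof. exact: asboolP. Qed.

Lemma poly_ext_weak q : weak_ideal (fun x => x \in poly_ext q).
Proof.
split=> [|a x y /poly_extP xq /poly_extP yq]; apply/poly_extP => i.
  by rewrite coef0 spec0.
rewrite coefD coefM (weak_idealD (spec_weak q)) //.
apply: (weak_ideal_sum _ (spec_weak q)) => j; exact: xq.
Qed.

Lemma poly_extC (q : Spec B) a : (a%:P \in poly_ext q) = (a \in q).
Proof.
apply/poly_extP/idP => [/(_ 0%N)|aq i]; rewrite coefC //=.
by case: (i == 0%N) => //; exact: spec0.
Qed.

Lemma poly_ext_first (q : Spec B) (p : {poly B}) : p \notin poly_ext q ->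
  exists i, p`_i \notin q /\ forall j, (j < i)%N -> p`_j \in q.
Proof.
move=> pq; have ex : exists i, p`_i \notin q.
  by have /existsNP[i /negP] := (elimN (poly_extP q p) pq); exists i.
case: (ex_minnP ex) => i pi min; exists i; split=> // j ltji.
by apply: contraTT ltji => /min; rewrite -leqNgt.
Qed.

(** As in Gauss's lemma: if i and j are the lowest indices of coefficients of a and b outside q, the
    coefficient of ab at i+j is their product modulo q. *)
Lemma poly_ext_prime q : prime_ideal (poly_ext q).
Proof.
apply: specP => [||a b abq]; first exact: poly_ext_weak.
  by rewrite poly_extC spec1.
apply/negPn/negP; rewrite negb_or => /andP[/poly_ext_first[i [ai mi]] /poly_ext_first[j [bj mj]]].
have /poly_extP/(_ (i + j)%N) := abq.
have lti : (i < (i + j).+1)%N by rewrite ltnS leq_addr.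
rewrite coefM (bigD1 (Ordinal lti)) //= addKn; set S := \sum_(_ < _ | _) _ => eS.
have : a`_i * b`_j \in q.
  rewrite -[_ * _](addrK S); apply: (weak_idealB (spec_weak q)) => //.
  rewrite /S; elim/big_ind: _ => [|x y|k ki]; [exact: spec0 | exact: weak_idealD (spec_weak q) | ].
  rewrite specM; case: (ltngtP k i) => [ltki|ltik|eki]; first by rewrite mi.
    by rewrite (mj (i + j - k)%N) ?orbT //; have := ltn_ord k; lia.
  by case/eqP: ki; apply/val_inj.
by rewrite specM (negPf ai) (negPf bj).
Qed.

Definition spec_poly q : Spec {poly B} := MkSpec (poly_ext_prime q).

Lemma spec_poly_chain c h : spec_chain c h -> spec_chain (fun i => spec_poly (c i)) h.
Proof.
move=> cc i /cc[sub [x x1 x0]]; split=> [p /poly_extP pc|].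
  by apply/poly_extP => j; exact/sub/pc.
by exists x%:P; rewrite [_ \in _]poly_extC.
Qed.

Lemma poly_ext_gens (q : Spec B) h (g : 'I_h -> B) (f : {poly B}) :
  local_gens q g -> f \in poly_ext q ->
  exists2 s, s \notin q & exists c : 'I_h -> {poly B}, s%:P * f = \sum_(i < h) c i * (g i)%:P.
Proof.
move=> [gq gens]; elim/poly_ind: f => [|p a IH] pq.
  by exists 1; rewrite ?spec1 //; exists (fun=> 0); rewrite mulr0 big1 // => i; rewrite mul0r.
have aq : a \in q by have /poly_extP/(_ 0%N) := pq; rewrite coefD coefMX coefC add0r.
have [|s sq [c ec]] := IH.
  apply/poly_extP => i; have /poly_extP/(_ i.+1) := pq.
  by rewrite coefD coefMX coefC addr0.
have [t tq [d ed]] := gens a aq; exists (s * t); first by rewrite specM negb_or sq.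
exists (fun i => t%:P * 'X * c i + (s * d i)%:P).
have -> : (s * t)%:P * (p * 'X + a%:P) = t%:P * 'X * (s%:P * p) + s%:P * (t * a)%:P.
  by rewrite !polyCM; ring.
rewrite ec ed rmorph_sum !mulr_sumr -big_split; apply: eq_bigr => i _ /=.
by rewrite !polyCM; ring.
Qed.

Local Notation Ciota := (@polyC B \o iota).

Lemma ieval_polyC s t p : ieval Ciota (fun i => (s i)%:P) t p = (ieval iota s t p)%:P.
Proof. by rewrite (ieval_rmorph (iota' := Ciota) (f := @polyC B)). Qed.

Lemma indep_polyX (q : Spec B) s t : indep iota q s t ->
  indep Ciota (poly_ext q) (fun i => if (i < t)%N then (s i)%:P else 'X) t.+1.
Proof.
move=> ind p; rewrite ievalS ltnn.
have -> : map_poly (ieval Ciota (fun i => if (i < t)%N then (s i)%:P else 'X) t)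
     (p : {poly (iterpoly K t)}) = map_poly polyC (map_poly (ieval iota s t) p).
  rewrite -map_poly_comp; apply: eq_map_poly => a /=.
  by rewrite -ieval_polyC; apply: eq_ieval => i ->.
rewrite -[_.['X]]/(_ \Po 'X) comp_polyXr => /poly_extP pq; apply/polyP => i.
by rewrite coef0; apply: ind; have := pq i; rewrite coef_map.
Qed.

Lemma indep_polyC (Q : Spec {poly B}) s t : indep iota (comap polyC Q) s t ->
  indep Ciota Q (fun i => (s i)%:P) t.
Proof. by move=> ind p; rewrite ieval_polyC => pQ; apply: ind. Qed.

(** Take F of least degree in Q outside q B[X]. Were its leading coefficient in q, removing the
    leading term would leave an element of Q of smaller degree, still outside q B[X]. *)
Lemma minimal_outside (Q : Spec {poly B}) q (f : {poly B}) :
  q = comap polyC Q -> f \in Q -> f \notin poly_ext q ->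
  exists F : {poly B}, [/\ F \in Q, lead_coef F \notin q &
    forall p : {poly B}, p \in Q -> (size p < size F)%N -> p \in poly_ext q].
Proof.
move=> qE fQ fq.
pose R d := `[< exists p : {poly B}, [/\ p \in Q, p \notin poly_ext q & size p = d] >].
have ex : exists d, R d by exists (size f); apply/asboolP; exists f.
case: (ex_minnP ex) => d /asboolP[F [FQ Fq sF]] min.
have small p : p \in Q -> (size p < size F)%N -> p \in poly_ext q.
  move=> pQ; apply: contraTT => pq; rewrite -leqNgt sF min //.
  by apply/asboolP; exists p.
exists F; split=> //; apply/negP => lq.
have F0 : F != 0 by apply: contraNneq Fq => ->; case: (poly_ext_weak q).
pose G := (lead_coef F)%:P * 'X^((size F).-1).
have Gq : G \in poly_ext q by rewrite /G mulrC (weak_idealM _ (poly_ext_weak q)) // poly_extC.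
have GQ : G \in Q by rewrite /G specM -comapE -qE lq.
have sFG : (size (F - G)%R < size F)%N.
  rewrite -[X in (_ < X)%N]prednK ?size_poly_gt0 // ltnS; apply/leq_sizeP => j.
  rewrite leq_eqVlt coefB coefCM coefXn => /orP[/eqP<-|lj].
    by rewrite eqxx mulr1 lead_coefE subrr.
  by rewrite gtn_eqF // mulr0 subr0 nth_default // (leq_trans (leqSpred _) lj).
case/negP: Fq; rewrite -[F](subrK G); apply: (weak_idealD (poly_ext_weak q)) => //.
by apply: small => //; apply: (weak_idealB (spec_weak Q)).
Qed.

(** Compare Q with the extension q B[X] of its contraction q. If they agree, the height is unchanged
    and X is a new transcendental residue; otherwise the height grows by one, and so does the number
    of generators. *)
Lemma regular_at_poly (Q : Spec {poly B}) : regular_at Ciota n.+1 Q.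
Proof.
pose q := comap polyC Q; have [h [t [c [g [s [htn cc cq gens ind]]]]]] := regB q.
have sub : {subset poly_ext q <= Q}.
  move=> p /poly_extP pq; rewrite -[p]coefK poly_def.
  elim/big_ind: _ => [|x y|i _]; [exact: spec0 | exact: weak_idealD (spec_weak Q) | ].
  by rewrite -mul_polyC specM -comapE pq.
have cqE : c h = q by apply: spec_ext.
have [Qsub|/existsNP[f /not_implyP[fQ /negP fq]]] := pselect {subset Q <= poly_ext q}.
  exists h, t.+1, (fun i => spec_poly (c i)), (fun i => (g i)%:P),
    (fun i => if (i < t)%N then (s i)%:P else 'X); split.
  - by rewrite addnS htn.
  - exact: spec_poly_chain.
  - by move=> p; rewrite cqE; apply/idP/idP => [/sub|/Qsub].
  - split=> [i|f /Qsub fq]; first by apply: sub; rewrite poly_extC; case: gens.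
    have [u uq [d e]] := poly_ext_gens gens fq.
    by exists u%:P; [rewrite -comapE | exists d].
  - by move=> p /Qsub; apply: indep_polyX.
have [F [FQ lF small]] := minimal_outside erefl fQ fq.
have qC (x : B) : (x%:P \in Q) = (x \in q) by [].
(* The chain of extended primes is continued by Q, and F joins the generators of q at index 0. *)
exists h.+1, t, (fun i => if (i <= h)%N then spec_poly (c i) else Q),
  (fun i => if unlift ord0 i is Some j then (g j)%:P else F), (fun i => (s i)%:P); split.
- by rewrite addSn htn.
- move=> i; rewrite ltnS /= => le_ih; rewrite le_ih; case: (ltngtP i h) le_ih => // [lt_ih|->] _.
    exact: (spec_poly_chain cc).
  by rewrite cqE; split=> //; exists f.
- by move=> p; rewrite ltnn.
- split=> [i|]; last move=> p' pQ'.
    by case: unliftP => [j _|_//]; rewrite qC; case: gens.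
  have [p pQ ->] : exists2 p : {poly B}, p \in Q & p' = p by exists p'.
  (* Pseudo-division by F: the multiplier is a power of [lead_coef F], which is outside Q, and the
     remainder lies in q B[X] by minimality of F. *)
  pose k := scalp p F; have e := Pdiv.Idomain.divp_eq p F.
  have rQ : p %% F \in Q.
    have -> : p %% F = lead_coef F ^+ k *: p - p %/ F * F by rewrite e addrC addKr.
    apply: (weak_idealB (spec_weak Q)); last by rewrite specM FQ orbT.
    by rewrite -mul_polyC specM pQ orbT.
  have F0 : F != 0 by apply: contraNneq lF => ->; rewrite lead_coef0 spec0.
  have [|u uq [d ed]] := poly_ext_gens gens (small _ rQ _).
    by rewrite ltn_modp.
  exists (u * lead_coef F ^+ k)%:P.
    by rewrite qC specM negb_or uq; apply: contra lF; exact: specX.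
  exists (fun i => if unlift ord0 i is Some j then d j else u%:P * (p %/ F)).
  rewrite polyCM -mulrA [_%:P * p]mul_polyC e mulrDr ed big_ord_recl /= unlift_none mulrA.
  by congr (_ + _); apply: eq_bigr => i _; rewrite liftK.
- exact: indep_polyC.
Qed.

End PolyStep.

Lemma regular_at_iterpoly n (Q : Spec (iterpoly K n)) : regular_at (iconst K n) n Q.
Proof.
elim: n Q => [|n IH] Q; first exact: regular_at_field.
exact: (regular_at_poly IH).
Qed.

(** * Localizations of polynomial rings *)

Section Birational.
Variables (A : comNzRingType) (iota : {rmorphism K -> A}) (s : nat -> A) (n : nat) (Q : Spec A).
Local Notation phi := (ieval iota s n).
Hypothesis phi_inj : forall p, phi p = 0 -> p = 0.
Hypothesis phi_frac : forall a, exists r b, phi r \notin Q /\ phi r * a = phi b.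

(** The two hypotheses make the localization of A at Q that of the polynomial ring at the
    contraction q of Q, so the chain, generators and independent elements found at q carry over. *)
Lemma regular_at_birational : regular_at iota n Q.
Proof.
pose q := comap phi Q.
have frac x : exists a r, r \notin q /\ phi r * x = phi a.
  by have [r [b [rQ e]]] := phi_frac x; exists b, r.
have frac_eq a b : phi a = phi b -> exists2 r, r \notin q & r * a = r * b.
  move=> e; exists 1; first exact: spec1.
  by rewrite !mul1r; apply/eqP; rewrite -subr_eq0; apply/eqP/phi_inj; rewrite rmorphB e subrr.
have [h [t [c [g [u [htn cc cq [gq gens] ind]]]]]] := regular_at_iterpoly q.
have cqE : c h = q by apply: spec_ext.
have [|d [dc dE]] := frac_ext_chain frac frac_eq cc; first by rewrite cqE.
have memQ r x a : r \notin q -> phi r * x = phi a -> (x \in Q) = (a \in q).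
  by move=> rq e; rewrite comapE -e specM -comapE (negPf rq).
exists h, t, d, (phi \o g), (phi \o u); split=> //.
- move=> x; rewrite dE // cqE; apply/asboolP/idP => [[a [r [aq rq e]]]|xQ].
    by rewrite (memQ r x a).
  by have [a [r [rq e]]] := frac x; exists a, r; rewrite -(memQ _ _ _ rq e).
- split=> [i|x xQ]; first exact: gq.
  have [a [r [rq e]]] := frac x; rewrite (memQ _ _ _ rq e) in xQ.
  have [r' r'q [b eb]] := gens _ xQ.
  exists (phi (r' * r)); first by rewrite -comapE specM negb_or r'q.
  exists (phi \o b); rewrite rmorphM -mulrA e -rmorphM eb rmorph_sum.
  by apply: eq_bigr => i _; rewrite rmorphM.
- move=> p; rewrite -(ieval_rmorph (iota := iconst K n)); last exact: ieval_const.
  by move=> /ind.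
Qed.

(** With h + t = n, the t elements independent modulo Q bound every chain below Q by h, which is
    also the number of generators. *)
Lemma regular_localization_birational :
  fg_ring A -> (forall x y : A, x * y = 0 -> x = 0 \/ y = 0) ->
  regular_local_ring (localization Q).
Proof.
move=> fgA dom; have [h [t [c [g [u [htn cc cq gens ind]]]]]] := regular_at_birational.
apply: regular_localization cc cq gens _ => // m c' cc' c'Q.
rewrite -(leq_add2r t) htn; apply: (chain_indep_leq (s := s) dom _ cc' (indep_sub c'Q ind)).
move=> a; have [r [b [rQ e]]] := phi_frac a; exists r, b; split=> //.
by apply: contraNneq rQ => ->; exact: spec0.
Qed.

End Birational.

Lemma fg_ring_iterpoly n : fg_ring (iterpoly K n).
Proof. by elim: n => [|n IH]; [exact: fg_ring_field | exact: fg_ring_poly]. Qed.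

End RegularData.

(** * Quotients and embedding dimension *)

Section QuotientSpec.
Variables (S : comNzRingType) (I : idealr S).
Local Notation A := {ideal_quot I}.
Local Open Scope quotient_scope.

Definition quot_pi (f : S) : A := \pi_A f.

Fact quot_pi_zmod_morphism : zmod_morphism quot_pi.
Proof. by move=> a b; rewrite /quot_pi !piE. Qed.

Fact quot_pi_monoid_morphism : monoid_morphism quot_pi.
Proof. by split=> [|a b]; rewrite /quot_pi !piE. Qed.

HB.instance Definition _ := GRing.isZmodMorphism.Build S A quot_pi quot_pi_zmod_morphism.
HB.instance Definition _ := GRing.isMonoidMorphism.Build S A quot_pi quot_pi_monoid_morphism.

Lemma quot_pi_surj (a : A) : exists f, quot_pi f = a.
Proof. by exists (repr a); rewrite /quot_pi reprK. Qed.

Lemma quot_pi_eq0 f : (quot_pi f == 0) = (f \in I).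
Proof. by rewrite -(rmorph0 quot_pi) /quot_pi /= -Quotient.idealrBE subr0. Qed.

Lemma quot_ker_spec (L : idomainType) (eps : {rmorphism S -> L}) :
  (forall f, f \in I -> eps f = 0) ->
  exists Q : Spec A, forall f, (quot_pi f \in Q) = (eps f == 0).
Proof.
move=> kerI; pose Q : {pred A} := fun a => eps (repr a) == 0.
have QE f : (quot_pi f \in Q) = (eps f == 0).
  rewrite [LHS]/(eps _ == 0); congr (_ == 0); apply/eqP; rewrite -subr_eq0 -rmorphB.
  by rewrite kerI // -quot_pi_eq0 rmorphB /= /quot_pi reprK subrr.
have Qp : prime_ideal Q.
  apply: specP => [||a b].
  - split=> [|a x y]; first by rewrite -(rmorph0 quot_pi) QE rmorph0.
    have [[[a' <-] [x' <-]] [y' <-]] := (quot_pi_surj a, quot_pi_surj x, quot_pi_surj y).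
    rewrite -rmorphM -rmorphD !QE rmorphD rmorphM => /eqP-> /eqP->.
    by rewrite mulr0 addr0.
  - by rewrite -(rmorph1 quot_pi) QE rmorph1 oner_eq0.
  - have [[a' <-] [b' <-]] := (quot_pi_surj a, quot_pi_surj b).
    by rewrite -rmorphM !QE rmorphM mulf_eq0.
by exists (MkSpec Qp).
Qed.

End QuotientSpec.

(** The D i are derivations at the point eps. Applied to the expressions of the s y j, they give C G
    = diag(eps (s j)), an invertible matrix of size r factoring through dimension n. *)
Lemma embdim_leq (S : comNzRingType) (L : fieldType) (eps : {rmorphism S -> L}) r n
    (D : 'I_r -> S -> L) (y : 'I_r -> S) (g : 'I_n -> S) :
  (forall i f h, D i (f + h) = D i f + D i h) ->
  (forall i f h, D i (f * h) = D i f * eps h + eps f * D i h) ->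
  (forall i j, D i (y j) = (i == j)%:R) ->
  (forall i, eps (y i) = 0) -> (forall k, eps (g k) = 0) ->
  (forall j, exists s (c : 'I_n -> S) z,
     [/\ eps s != 0, s * y j = \sum_(k < n) c k * g k + z & forall i, D i z = 0]) ->
  (r <= n)%N.
Proof.
move=> DD DM Dy y0 g0 /choice[s /choice[c /choice[z zP]]].
pose C : 'M[L]_(r, n) := \matrix_(j, k) eps (c j k).
pose G : 'M[L]_(n, r) := \matrix_(k, i) D i (g k).
have D0 i : D i 0 = 0 by apply: (addrI (D i 0)); rewrite -DD !addr0.
have CG : C *m G = diag_mx (\row_j eps (s j)).
  apply/matrixP => j i; rewrite !mxE; have [_ e Dz] := zP j.
  have := congr1 (D i) e; rewrite DM y0 mulr0 add0r Dy DD Dz addr0.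
  rewrite (_ : D i (\sum_(k < n) c j k * g k) = \sum_k eps (c j k) * D i (g k)).
    move=> eD; rewrite (eq_bigr (fun k => eps (c j k) * D i (g k))) => [|k _]; last by rewrite !mxE.
    by rewrite -eD eq_sym mulr_natr.
  elim/big_ind2: _ => [//|_ u _ v <- <-|k _]; first exact: DD.
  by rewrite DM g0 mulr0 add0r.
have uD : C *m G \in unitmx.
  rewrite CG unitmxE det_diag unitfE; apply/prodf_neq0 => j _; rewrite mxE.
  by case: (zP j).
rewrite -(mxrank_unit uD); exact: leq_trans (mxrankM_maxl _ _) (rank_leq_col _).
Qed.

Section FracClosed.
Variables (K : fieldType) (A : comNzRingType) (iota : {rmorphism K -> A}).
Variables (s : nat -> A) (n : nat) (Q : Spec A).
Local Notation phi := (ieval iota s n).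

Definition has_frac (a : A) := exists r b, phi r \notin Q /\ phi r * a = phi b.

Lemma has_frac_img b : has_frac (phi b).
Proof. by exists 1, b; rewrite rmorph1 spec1 mul1r. Qed.

Lemma has_fracD x y : has_frac x -> has_frac y -> has_frac (x + y).
Proof.
move=> [r [a [rQ e]]] [t [b [tQ f]]]; exists (r * t), (t * a + r * b).
by rewrite rmorphM specM negb_or rQ tQ rmorphD !rmorphM -e -f; split=> //; ring.
Qed.

Lemma has_fracM x y : has_frac x -> has_frac y -> has_frac (x * y).
Proof.
move=> [r [a [rQ e]]] [t [b [tQ f]]]; exists (r * t), (a * b).
by rewrite !rmorphM specM negb_or rQ tQ -e -f; split=> //; ring.
Qed.

Lemma has_frac_solve x y z : x \notin Q -> has_frac x -> has_frac z -> x * y = z -> has_frac y.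
Proof.
move=> xQ [r [a [rQ e]]] [t [b [tQ f]]] g; exists (t * a), (r * b).
by rewrite !rmorphM -e -f -g !specM !negb_or tQ rQ xQ; split=> //; ring.
Qed.

End FracClosed.

(** * Vertices and cells *)

Section VertexGeometry.
Implicit Types (v w c : Z2) (P : {fset Z2}).

(** The points v and w are opposite corners, diagonal or anti-diagonal, of an inner interval. *)
Definition opposite P v w : Prop :=
  inner_interval P (Num.min v.1 w.1, Num.min v.2 w.2) (Num.max v.1 w.1, Num.max v.2 w.2).

Lemma le_Z2 v w : (v <= w)%O = (v.1 <= w.1) && (v.2 <= w.2).
Proof. by case: v w => [v1 v2] [w1 w2]. Qed.

Lemma cell_ofE a b c :
  cell_of a b c = [&& a.1 <= c.1, c.1 < b.1, a.2 <= c.2 & c.2 < b.2].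
Proof. by rewrite /cell_of !le_Z2 /=; lia. Qed.

Lemma oppositeP P v w : opposite P v w <->
  [/\ v.1 != w.1, v.2 != w.2 & forall c,
    Num.min v.1 w.1 <= c.1 < Num.max v.1 w.1 ->
    Num.min v.2 w.2 <= c.2 < Num.max v.2 w.2 -> c \in P].
Proof.
rewrite /opposite /inner_interval /proper_interval /=; split.
  move=> [/andP[n1 n2] cP]; split; [lia | lia | move=> c c1 c2].
  by apply: cP; rewrite cell_ofE /=; lia.
move=> [n1 n2 cP]; split; first by lia.
move=> c; rewrite cell_ofE /= => c12; apply: cP; lia.
Qed.

Lemma opposite_sym P v w : opposite P v w -> opposite P w v.
Proof. by rewrite /opposite minC (minC v.2) maxC (maxC v.2). Qed.

Lemma cell_verticesP c v :
  (v \in cell_vertices c) =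
  [&& (v.1 == c.1) || (v.1 == c.1 + 1) & (v.2 == c.2) || (v.2 == c.2 + 1)].
Proof.
case: c v => [c1 c2] [v1 v2]; rewrite /cell_vertices /cell_upper !inE !xpair_eqE /=.
by do 4! case: eqP => //.
Qed.

Lemma verticesP P v :
  reflect (exists2 c, c \in P & v \in cell_vertices c) (v \in vertices P).
Proof.
rewrite /vertices; apply: (iffP (bigfcupP _ _ _ _)) => [[c /andP[cP _] vc]|[c cP vc]]; exists c => //.
by rewrite cP.
Qed.

(* [far_corner v c] is the vertex of the cell [c] farthest from [v], and
   [near_cell v w] the cell at the corner [w] of the rectangle spanned by [v] and [w]. *)
Definition far_corner v c : Z2 :=
  (if v.1 <= c.1 then c.1 + 1 else c.1, if v.2 <= c.2 then c.2 + 1 else c.2).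

Definition near_cell v w : Z2 :=
  (if v.1 < w.1 then w.1 - 1 else w.1, if v.2 < w.2 then w.2 - 1 else w.2).

Lemma near_cellK v w : v.1 != w.1 -> v.2 != w.2 -> far_corner v (near_cell v w) = w.
Proof.
case: v w => [v1 v2] [w1 w2] /= n1 n2; rewrite /far_corner /near_cell /=.
by congr pair; do 2 case: ifP; lia.
Qed.

Lemma near_cell_in P v w : opposite P v w -> near_cell v w \in P.
Proof.
case: v w => [v1 v2] [w1 w2] /oppositeP /= [n1 n2 cP]; apply: cP => /=; case: ifP; lia.
Qed.

(** The condition forces P to contain the bounding rectangle of any two of its cells; applied to
    cells with extremal coordinates, this fills the bounding rectangle of P. *)
Lemma corners_inner_interval P : P != fset0 ->
  (forall v c, v \in vertices P -> c \in P -> opposite P v (far_corner v c)) ->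
  is_inner_interval P.
Proof.
move=> /fset0Pn[c0 c0P] opp.
have hull c c' d : c \in P -> c' \in P ->
    Num.min c.1 c'.1 <= d.1 <= Num.max c.1 c'.1 ->
    Num.min c.2 c'.2 <= d.2 <= Num.max c.2 c'.2 -> d \in P.
  move=> cP c'P; case: c c' d cP c'P => [c1 c2] [c'1 c'2] [d1 d2] cP c'P /= le1 le2.
  (* The corner of c' farthest from c: the rectangle from v to [far_corner v c] then covers both
     cells. *)
  pose v : Z2 := (if c'1 <= c1 then c'1 else c'1 + 1, if c'2 <= c2 then c'2 else c'2 + 1).
  have vP : v \in vertices P.
    by apply/verticesP; exists (c'1, c'2) => //; rewrite cell_verticesP /=; do 2 case: ifP => _; lia.
  have /oppositeP[_ _] := opp v (c1, c2) vP cP; apply; rewrite /v /far_corner /=; do ! case: ifP; lia.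
have ext (f : Z2 -> int) : exists c, c \in P /\ forall c', c' \in P -> f c <= f c'.
  have [c _ cmin] := @arg_minP _ _ _ [` c0P]%fset xpredT (fun c : P => f (val c)) isT.
  exists (val c); split=> [|c' c'P]; first exact: valP.
  exact: (cmin [` c'P]%fset).
have [a1 [a1P a1m]] := ext fst; have [a2 [a2P a2m]] := ext snd.
have [b1 [b1P b1m]] := ext (fun c => - c.1); have [b2 [b2P b2m]] := ext (fun c => - c.2).
have aP : (a1.1, a2.2) \in P.
  have := a1m _ a2P; have := a2m _ a1P => /= h1 h2.
  by apply: (hull a1 a2) => //=; lia.
have bP : (b1.1, b2.2) \in P.
  have := b1m _ b2P; have := b2m _ b1P => /= h1 h2.
  by apply: (hull b1 b2) => //=; lia.
exists (a1.1, a2.2), (b1.1 + 1, b2.2 + 1); split=> [|c].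
  have := a1m _ b1P; have := a2m _ b2P; rewrite /proper_interval /=; lia.
rewrite cell_ofE /=; apply/idP/idP => [cP|h].
  have := a1m _ cP; have := a2m _ cP; have := b1m _ cP; have := b2m _ cP => /=; lia.
by apply: (hull _ _ c aP bP) => /=; lia.
Qed.

End VertexGeometry.

(** * The cell ring *)

Section CellRing.
Variables (K : fieldType) (P : {fset Z2}).
Local Notation S := (cell_ring K P).
Local Notation I := (cell_ideal K P).
Local Notation A := {ideal_quot I}.
Local Notation V := (vertices P).

Definition cell_eval (L : comNzRingType) (rho : {rmorphism K -> L}) (y : V -> L) :
  {rmorphism S -> L} := mmap rho (y \o enum_val).

Lemma cell_evalX L rho y v : @cell_eval L rho y (cell_var K v) = y v.
Proof. by rewrite /cell_eval /cell_var /= mmapX mmap1U /= enum_rankK. Qed.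

Lemma cell_evalC L rho y k : @cell_eval L rho y k%:MP_[#|{: V}|] = rho k.
Proof. exact: mmapC. Qed.

Lemma minor_opposite (a b c d : V) :
  inner_interval P (val a) (val b) ->
  val c = ((val a).1, (val b).2) -> val d = ((val b).1, (val a).2) ->
  opposite P (val a) (val b) /\ opposite P (val c) (val d).
Proof.
move: (val a) (val b) (val c) (val d) => [a1 a2] [b1 b2] {}c {}d ab -> ->.
have [/andP[/= lt1 lt2] _] := ab; rewrite /opposite /=.
have [l1 l2] := (ltW lt1, ltW lt2).
by rewrite (min_l l1) (max_r l1) (min_l l2) (max_r l2) (min_r l2) (max_l l2).
Qed.

Definition cell_pi : {rmorphism S -> A} := @quot_pi S I.
Definition cell_const : {rmorphism K -> A} := cell_pi \o @mpolyC #|{: V}| K.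
Definition cell_x (v : V) : A := cell_pi (cell_var K v).

Lemma cell_ind (Pr : A -> Prop) :
  (forall k, Pr (cell_const k)) -> (forall v, Pr (cell_x v)) ->
  (forall a b, Pr a -> Pr b -> Pr (a + b)) -> (forall a b, Pr a -> Pr b -> Pr (a * b)) ->
  forall a, Pr a.
Proof.
move=> PC Px PD PM a; have [f <-] := quot_pi_surj a.
change (Pr (cell_pi f)); elim/mpolyind: (f : {mpoly K[#|{: V}|]}) => {f} [|k m p _ _ Pp].
  by rewrite -[0]mpolyC0; exact: PC.
rewrite rmorphD; apply: PD => //; rewrite -mul_mpolyC rmorphM; apply: (PM _ _); first exact: PC.
rewrite mpolyXE_id rmorph_prod; apply: (big_ind Pr) => [||i _].
- by rewrite -(rmorph1 cell_const); exact: PC.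
- exact: PM.
rewrite rmorphXn; elim: (m i) => [|j IH].
  by rewrite expr0 -(rmorph1 cell_const); exact: PC.
by rewrite exprS; apply: PM => //; rewrite -[i]enum_valK; exact: Px.
Qed.

Lemma cell_eval_ideal (L : comNzRingType) (rho : {rmorphism K -> L}) (y : V -> L) :
  (forall a b c d : V, inner_interval P (val a) (val b) ->
    val c = ((val a).1, (val b).2) -> val d = ((val b).1, (val a).2) ->
    y a * y b = y c * y d) ->
  forall f, f \in I -> cell_eval rho y f = 0.
Proof.
move=> yP f fI; apply: (ideal_gen_min (I := fun f => cell_eval rho y f = 0) _ _ fI)
  => [|g [a [b [c [d [ab ec ed ->]]]]]].
  split=> [|a x z ex ez]; first exact: rmorph0.
  by rewrite rmorphD rmorphM ex ez mulr0 addr0.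
by rewrite rmorphB !rmorphM !cell_evalX (yP a b c d) // subrr.
Qed.

Lemma cell_x_rel (a b c d : V) : inner_interval P (val a) (val b) ->
  val c = ((val a).1, (val b).2) -> val d = ((val b).1, (val a).2) ->
  cell_x a * cell_x b = cell_x c * cell_x d.
Proof.
move=> ab ec ed; apply/eqP; rewrite -subr_eq0 -!rmorphM -rmorphB quot_pi_eq0.
by apply: ideal_gen_mem; exists a, b, c, d.
Qed.

(** The point with all coordinates 1 satisfies every minor. *)
Lemma cell_x_neq0 v : cell_x v != 0.
Proof.
rewrite /cell_x /cell_pi quot_pi_eq0; apply/negP.
move=> /(@cell_eval_ideal K idfun (fun=> 1) _); rewrite cell_evalX => e.
by have /eqP := e (fun _ _ _ _ _ _ _ => erefl); rewrite oner_eq0.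
Qed.

Lemma fg_ring_cell : fg_ring A.
Proof.
pose x i := if insub i is Some j then cell_x (enum_val (j : 'I_#|{: V}|)) else 0.
pose phi := ieval cell_const x #|{: V}|.
apply: (fg_ring_surj (f := phi)); last exact: fg_ring_iterpoly.
apply: cell_ind => [k|v|_ _ [a <-] [b <-]|_ _ [a <-] [b <-]].
- by exists (iconst K _ k); rewrite /phi ieval_const.
- exists (ivar K _ (enum_rank v)); rewrite /phi ieval_var //.
  by rewrite /x valK enum_rankK.
- by exists (a + b); rewrite rmorphD.
- by exists (a * b); rewrite rmorphM.
Qed.

Hypothesis primeI : prime_ideal I.

Lemma cell_domain (x y : A) : x * y = 0 -> x = 0 \/ y = 0.
Proof.
have [[f <-] [g <-]] := (quot_pi_surj x, quot_pi_surj y).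
move/eqP; rewrite -rmorphM quot_pi_eq0 => /(proj2 primeI).
by rewrite -!(quot_pi_eq0 I) => /orP[] /eqP; [left|right].
Qed.

Definition upper_corners : {set V} := [set v | `[< exists2 c, c \in P & val v = cell_upper c >]].

Lemma card_upper_corners : (#|` P| <= #|upper_corners|)%N.
Proof.
have upP (c : P) : cell_upper (val c) \in V.
  by apply/verticesP; exists (val c); rewrite ?(valP c) // cell_verticesP /= !eqxx !orbT.
pose u (c : P) : V := [` upP c]%fset.
have u_inj : injective u.
  move=> c c' /(congr1 val) /= [/addIr e1 /addIr e2]; apply/val_inj.
  by rewrite /= [fsval c]surjective_pairing e1 e2 -surjective_pairing.
rewrite cardfE -(card_imset _ u_inj); apply/subset_leq_card/fintype.subsetP => _ /imsetP[c _ ->].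
by rewrite inE; apply/asboolP; exists (val c); first exact: valP.
Qed.

(* Modulo a cell [a, b] with antidiagonal corners c, d, the upper corner satisfies
   x_b = x_c x_d / x_a, so the variables that are not upper corners generate the
   fraction field. *)
Lemma cell_dim_leq (c : nat -> Spec A) m (t : nat -> A) k :
  spec_chain c m -> indep cell_const (c m) t k -> (m + k + #|` P| <= #|{: V}|)%N.
Proof.
move=> cc ind; pose T := ~: upper_corners.
suff le : (m + k <= #|T|)%N.
  rewrite -(cardsC upper_corners) addnC; exact: leq_add card_upper_corners le.
pose x i := nth 0 (map cell_x (enum T)) i.
apply: (chain_indep_leq (s := x) cell_domain _ cc ind).
have [Z ZE] := zero_spec cell_domain.
suff frac a : has_frac cell_const x #|T| Z a.
  by move=> a; have [r [b [rZ e]]] := frac a; exists r, b; rewrite -ZE.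
elim/cell_ind: a => [r|v|a b|a b]; [|move: v|exact: has_fracD|exact: has_fracM].
  by rewrite -(ieval_const cell_const x #|T|); exact: has_frac_img.
(* A measure for the induction: the other three corners of a cell have a smaller coordinate sum than
   its upper corner. *)
pose ht (v : V) := #|[set w : V | (val w).1 + (val w).2 < (val v).1 + (val v).2]|.
have ht_lt (v w : V) : (val w).1 + (val w).2 < (val v).1 + (val v).2 -> (ht w < ht v)%N.
  move=> lt_wv; apply/proper_card/properP; split.
    by apply/fintype.subsetP => u; rewrite !inE => /lt_trans; apply.
  by exists w; rewrite !inE ?ltxx.
move=> v; have [n] := ubnP (ht v); elim: n v => // n IH v /ltnSE htv.
have [vT|] := boolP (v \in T).
  have ltiT : (index v (enum T) < #|T|)%N by rewrite cardE index_mem mem_enum.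
  have -> : cell_x v = x (index v (enum T)).
    by rewrite /x (nth_map v) ?index_mem ?mem_enum // nth_index // mem_enum.
  by rewrite -(ieval_var cell_const x ltiT); exact: has_frac_img.
rewrite inE negbK inE => /asboolP[[p q] pqP ev].
have vert (w : Z2) : w \in cell_vertices (p, q) -> w \in V.
  by move=> we; apply/verticesP; exists (p, q).
have Va : (p, q) \in V by apply: vert; rewrite cell_verticesP !eqxx.
have Vc : (p, q + 1) \in V by apply: vert; rewrite cell_verticesP !eqxx orbT.
have Vd : (p + 1, q) \in V by apply: vert; rewrite cell_verticesP !eqxx orbT.
have IHv (i j : int) (wV : (i, j) \in V) : i + j < p + q + 2 ->
    has_frac cell_const x #|T| Z (cell_x [` wV]%fset).
  move=> lt_wv; apply: IH; apply: leq_trans htv; apply: ht_lt; rewrite ev /=.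
  by apply: lt_le_trans lt_wv _; rewrite addrACA.
apply: (@has_frac_solve _ _ _ _ _ _ (cell_x [` Va]%fset) _
  (cell_x [` Vc]%fset * cell_x [` Vd]%fset)).
- by rewrite ZE cell_x_neq0.
- by apply: IHv; lia.
- by apply: has_fracM; apply: IHv; lia.
- apply: cell_x_rel => /=; rewrite ev //.
  split=> [|[c1 c2]]; first by rewrite /proper_interval /= !ltrDl.
  rewrite cell_ofE /= => h; suff -> : (c1, c2) = (p, q) by [].
  by congr pair; lia.
Qed.

End CellRing.
(** * Singular points *)

Section Singular.
Variables (K : fieldType) (P : {fset Z2}).
Local Notation S := (cell_ring K P).
Local Notation I := (cell_ideal K P).
Local Notation A := {ideal_quot I}.
Local Notation V := (vertices P).
Local Notation pi := (cell_pi K P).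

Lemma mderiv_var (v w : V) :
  mderiv (enum_rank v) (cell_var K w : {mpoly K[#|{: V}|]}) = (v == w)%:R.
Proof.
rewrite /cell_var mderivX mnm1E (inj_eq enum_rank_inj) eq_sym.
case: eqP => [->|_]; last by rewrite scale0r.
by rewrite scale1r -{1}[U_(_)%MM]add0m addmK mpolyX0.
Qed.

(** The partial derivatives along W, evaluated at y, vanish on the ideal: in a minor a variable of W
    is multiplied only by the variable of an opposite vertex, which is zero at y. They are thus
    independent derivations of A at Q, and their number bounds the number of generators from
    below. *)
Lemma cell_embdim_leq (L : fieldType) (rho : {rmorphism K -> L}) (y : V -> L)
    (W : {set V}) (Q : Spec A) n (g : 'I_n -> A) :
  (forall f, (pi f \in Q) = (cell_eval rho y f == 0)) ->
  (forall w, w \in W -> y w = 0) ->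
  (forall v w : V, opposite P (val v) (val w) -> v \in W -> y w = 0) ->
  local_gens Q g -> (#|W| <= n)%N.
Proof.
move=> QE yW yopp [gQ gens]; pose ev := cell_eval rho y.
pose D (i : 'I_#|W|) (f : S) : L := ev (mderiv (enum_rank (enum_val i)) f).
have DM i f h : D i (f * h) = D i f * ev h + ev f * D i h.
  by rewrite /D mderivM rmorphD !rmorphM.
have DD i f h : D i (f + h) = D i f + D i h by rewrite /D mderivD rmorphD.
have DB i f h : D i (f - h) = D i f - D i h by rewrite /D mderivB rmorphB.
have DX i w : D i (cell_var K w) = (enum_val i == w)%:R.
  by rewrite /D mderiv_var rmorph_nat.
have DI i f : f \in I -> ev f = 0 /\ D i f = 0.
  apply: (ideal_gen_min (I := fun f => ev f = 0 /\ D i f = 0)).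
    split=> [|a x z [ex Dx] [ez Dz]]; first by rewrite /D mderiv0 rmorph0.
    by rewrite DD DM rmorphD rmorphM ex ez Dx Dz !mulr0 !addr0.
  move=> _ [a [b [c [d [ab ec ed ->]]]]]; split.
    apply/eqP; rewrite -QE.
    suff -> : pi (cell_var K a * cell_var K b - cell_var K c * cell_var K d) = 0.
      exact: spec0.
    by rewrite rmorphB !rmorphM; apply/eqP; rewrite subr_eq0; apply/eqP/cell_x_rel.
  have [oab ocd] := minor_opposite ab ec ed.
  rewrite DB !DM !DX /ev !cell_evalX.
  have zero (v w : V) : opposite P (val v) (val w) ->
      (enum_val i == v)%:R * y w + y v * (enum_val i == w)%:R = 0.
    have iW := enum_valP i.
    move=> o; case: (eqVneq (enum_val i) v) => [eiv|_].
      have vW : v \in W by rewrite -eiv.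
      by rewrite (yopp v w o vW) (yW v vW) mulr0 mul0r addr0.
    rewrite mul0r add0r; case: (eqVneq (enum_val i) w) => [eiw|_]; last by rewrite mulr0.
    by rewrite (yopp w v) ?mul0r //; [exact: opposite_sym | rewrite -eiw].
  by rewrite !zero // subrr.
have /choice[g' g'E] k : exists f, pi f = g k by exact: quot_pi_surj.
apply: (@embdim_leq S L ev _ _ D (fun i => cell_var K (enum_val i)) g' DD DM).
- by move=> i j; rewrite DX (inj_eq enum_val_inj).
- by move=> i; rewrite /ev cell_evalX yW ?enum_valP.
- by move=> k; apply/eqP; rewrite -QE g'E.
move=> j; have [|s sQ [c e]] := gens (cell_x K (enum_val j)).
  by rewrite QE cell_evalX yW ?enum_valP.
have [s' es] : exists f, pi f = s by exact: quot_pi_surj.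
have /choice[c' ec] k : exists f, pi f = c k by exact: quot_pi_surj.
(* The error made by lifting the relation from A to S lies in the ideal, hence is killed by the
   derivations. *)
exists s', c', (s' * cell_var K (enum_val j) - \sum_(k < n) c' k * g' k); split.
- by rewrite -QE es.
- by rewrite addrC subrK.
move=> i; case: (DI i (s' * cell_var K (enum_val j) - \sum_(k < n) c' k * g' k)) => //.
rewrite -quot_pi_eq0 -[quot_pi _ _]/(pi _) rmorphB rmorphM rmorph_sum es subr_eq0.
apply/eqP; apply: etrans e _; apply: eq_bigr => k _.
by rewrite rmorphM ec g'E.
Qed.

Hypothesis primeI : prime_ideal I.

(** Regularity supplies one n that is both the length of a chain below Q and a number of generators:
    it is at least |W|, and n + t + |P| is at most |V|. *)
Lemma regular_bound (L : fieldType) (rho : {rmorphism K -> L}) (y : V -> L)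
    (W : {set V}) (Q : Spec A) (s : nat -> A) t :
  (forall f, (pi f \in Q) = (cell_eval rho y f == 0)) ->
  (forall w, w \in W -> y w = 0) ->
  (forall v w : V, opposite P (val v) (val w) -> v \in W -> y w = 0) ->
  indep (cell_const K P) Q s t ->
  regular_local_ring (localization Q) -> (#|W| + t + #|` P| <= #|{: V}|)%N.
Proof.
move=> QE yW yopp ind /regular_localization_inv[n [c [g [cc cQ gens]]]].
have leW := cell_embdim_leq QE yW yopp gens.
have := cell_dim_leq primeI cc (indep_sub cQ ind); apply: leq_trans.
by rewrite !leq_add2r.
Qed.

End Singular.

(** * The theorem *)

Section Generic.
Variable K : fieldType.

Definition frac_const n : {rmorphism K -> {fraction iterpoly K n}} :=
  @tofrac (iterpoly K n) \o iconst K n.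

Lemma ieval_ivar n p : ieval (iconst K n) (ivar K n) n p = p.
Proof.
elim: n p => [|n IH] p //; rewrite ievalS /= eqxx.
have -> : map_poly (ieval (iconst K n.+1) (ivar K n.+1) n) (p : {poly (iterpoly K n)}) =
    map_poly polyC (p : {poly (iterpoly K n)}).
  apply: eq_map_poly => a; rewrite -[in RHS](IH a).
  rewrite (ieval_rmorph (iota' := iconst K n.+1) (f := @polyC (iterpoly K n))) //.
  by apply: eq_ieval => i lti /=; rewrite ltn_eqF.
exact: comp_polyXr.
Qed.

Lemma ieval_frac n p :
  ieval (frac_const n) (fun i => tofrac (ivar K n i)) n p = tofrac p.
Proof.
rewrite -[in RHS](ieval_ivar p).
by rewrite (ieval_rmorph (iota' := frac_const n) (f := @tofrac (iterpoly K n))).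
Qed.

Lemma ivar_neq0 n i : (i < n)%N -> ivar K n i != 0.
Proof.
move=> ltin; apply: contraTneq isT => e.
have := ieval_var idfun (fun=> 1 : K) ltin; rewrite e rmorph0 => /esym/eqP.
by rewrite oner_eq0.
Qed.

End Generic.

(** * Zero-dimensional subspaces of the spectrum *)

Section SpecTopology.
Variable A : comNzRingType.
Local Open Scope classical_set_scope.
Local Notation Z := (@singular_locus A).

Definition spec_above (Q : Spec A) : set (Spec A) :=
  [set Q' : Spec A | forall f, f \in Q -> f \in Q'].

Lemma spec_above_closed Q : zariski_closed (spec_above Q).
Proof. by exists [set f : A | f \in Q]. Qed.

(** Q is a generic point: a closed set containing it contains every prime above it. *)
Lemma spec_above_irreducible (Y : set (Spec A)) Q : Y Q -> irreducible_set (Y `&` spec_above Q).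
Proof.
move=> YQ; have QQ : (Y `&` spec_above Q) Q by split.
split=> [|_ _ [E1 ->] [E2 ->] cov]; first by exists Q.
by case: (cov Q QQ) => EQ; [left|right] => Q' [_ QQ'] f /EQ/QQ'.
Qed.

Lemma isolated_singularity_antichain Q Q' : isolated_singularity A ->
  Z Q -> Z Q' -> {subset Q <= Q'} -> {subset Q' <= Q}.
Proof.
move=> [_ max] ZQ ZQ' sub; apply: contrapT => nsub.
have /max : has_chain [set F | irreducible_set F /\
    exists2 C, zariski_closed C & F = Z `&` C] 1; last by [].
(* The larger prime has the smaller closure, so it comes first in the chain. *)
exists (fun i => if i is 0%N then Z `&` spec_above Q' else Z `&` spec_above Q); split.
  by case=> [|i] _; split;
    [exact: spec_above_irreducible | exists (spec_above Q') => //; exact: spec_above_closed |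
     exact: spec_above_irreducible | exists (spec_above Q) => //; exact: spec_above_closed].
case=> // _; split=> [Q'' [ZQ'' above]|sub'].
  by split=> // f /sub/above.
have QQ : (Z `&` spec_above Q) Q by split.
by apply: nsub; case: (sub' Q QQ).
Qed.

Lemma isolated_singularity1 Q : Z Q -> (forall Q', Z Q' -> Q' = Q) -> isolated_singularity A.
Proof.
move=> ZQ uniqQ; split=> [|[//|n] [c [cF cS]]].
  exists (fun=> Z `&` spec_above Q); split=> // i _; split.
    exact: spec_above_irreducible.
  by exists (spec_above Q) => //; exact: spec_above_closed.
have [[[Q0 c0Q0] _] [C0 _ e0]] := cF 0%N isT.
have [sub nsub] := cS 0%N isT; case: nsub => Q1 c1Q1.
have [_ [C1 _ e1]] := cF 1%N isT.
have ZQ1 : Z Q1 by rewrite e1 in c1Q1; case: c1Q1.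
have ZQ0 : Z Q0 by rewrite e0 in c0Q0; case: c0Q0.
by rewrite (uniqQ _ ZQ1) -(uniqQ _ ZQ0).
Qed.

Lemma isolated_singularity_nonempty : isolated_singularity A -> exists Q, Z Q.
Proof.
by move=> [[c [/(_ 0%N isT)[[[Q cQ] _] [C _ e]] _]] _]; exists Q; rewrite e in cQ; case: cQ.
Qed.

End SpecTopology.

Section CellTheorem.
Variables (K : fieldType) (P : {fset Z2}).
Local Notation S := (cell_ring K P).
Local Notation I := (cell_ideal K P).
Local Notation A := {ideal_quot I}.
Local Notation V := (vertices P).
Local Notation pi := (cell_pi K P).
Local Notation iota := (cell_const K P).
Local Notation x := (@cell_x K P).
Hypothesis primeI : prime_ideal I.

Lemma cell_eval_rmorph (L L' : comNzRingType) (rho : {rmorphism K -> L})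
    (rho' : {rmorphism K -> L'}) (h : {rmorphism L -> L'}) y (f : S) :
  (forall k, h (rho k) = rho' k) ->
  h (cell_eval rho y f) = cell_eval rho' (h \o y) f.
Proof.
move=> hr; rewrite /cell_eval /= /mmap rmorph_sum; apply: eq_bigr => m _.
rewrite rmorphM hr /mmap1 rmorph_prod; congr (_ * _); apply: eq_bigr => i _.
by rewrite rmorphXn.
Qed.

Lemma pi_ieval s n p :
  pi (ieval (@mpolyC #|{: V}| K : {rmorphism K -> S}) s n p) = ieval iota (pi \o s) n p.
Proof. exact: ieval_rmorph. Qed.

Lemma cell_eval_ieval n (L : comNzRingType) (rho : {rmorphism K -> L}) y s p :
  cell_eval rho y (ieval (@mpolyC #|{: V}| K : {rmorphism K -> S}) s n p) =
  ieval rho (cell_eval rho y \o s) n p.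
Proof. by apply: ieval_rmorph => k; exact: cell_evalC. Qed.

Lemma cell_x_opposite (v w p q : V) : opposite P (val v) (val w) ->
  val p = ((val v).1, (val w).2) -> val q = ((val w).1, (val v).2) ->
  x v * x w = x p * x q.
Proof.
move=> o; case ev: (val v) o => [v1 v2]; case ew: (val w) => [w1 w2] /oppositeP + ep eq.
move=> [/= n1 n2 cP].
have rect (a b : Z2) : a.1 < b.1 -> a.2 < b.2 ->
    (forall c1 c2 : int, a.1 <= c1 < b.1 -> a.2 <= c2 < b.2 -> (c1, c2) \in P) ->
    inner_interval P a b.
  move=> lt1 lt2 abP; split; first by rewrite /proper_interval lt1.
  by case=> c1 c2; rewrite cell_ofE /= => /and4P[? ? ? ?]; apply: abP; apply/andP.
case: (ltgtP v1 w1) n1 => // lt1 _; case: (ltgtP v2 w2) n2 => // lt2 _.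
- by apply: cell_x_rel; rewrite ?ev ?ew //; apply: rect => //= c1 c2 h1 h2; apply: cP => /=; lia.
- symmetry; apply: cell_x_rel; rewrite ?ep ?eq ?ev ?ew //.
  by apply: rect => //= c1 c2 h1 h2; apply: cP => /=; lia.
- rewrite [RHS]mulrC [LHS]mulrC; symmetry; apply: cell_x_rel; rewrite ?ep ?eq ?ev ?ew //=.
  by apply: rect => //= c1 c2 h1 h2; apply: cP => /=; lia.
- rewrite [RHS]mulrC [LHS]mulrC; apply: cell_x_rel; rewrite ?ep ?eq ?ev ?ew //.
  by apply: rect => //= c1 c2 h1 h2; apply: cP => /=; lia.
Qed.

(** * The origin and the coordinate axes *)

Lemma cell_origin_spec : exists M : Spec A,
  forall f, (pi f \in M) = (cell_eval idfun (fun=> 0) f == 0).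
Proof.
apply: quot_ker_spec; apply: cell_eval_ideal => a b c d _ _ _.
by rewrite !mul0r.
Qed.

(** Every element is congruent, modulo both primes at once, to the same constant k, and it belongs
    to either prime exactly when k = 0. *)
Lemma cell_spec_origin (Q Q' : Spec A) :
  (forall v, x v \in Q) -> (forall v, x v \in Q') -> Q = Q'.
Proof.
move=> xQ xQ'; apply: spec_ext => a.
have [k [kQ kQ']] : exists k, a - iota k \in Q /\ a - iota k \in Q'.
  elim/cell_ind: a => [k|v|a b [k [kQ kQ']] [l [lQ lQ']]|a b [k [kQ kQ']] [l [lQ lQ']]].
  - by exists k; rewrite subrr !spec0.
  - by exists 0; rewrite rmorph0 subr0 xQ xQ'.
  - exists (k + l); rewrite rmorphD opprD addrACA.
    by split; [apply: (weak_idealD (spec_weak Q)) | apply: (weak_idealD (spec_weak Q'))].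
  - exists (k * l).
    have -> : a * b - iota (k * l) = b * (a - iota k) + iota k * (b - iota l).
      by rewrite rmorphM; ring.
    have R (R : Spec A) : a - iota k \in R -> b - iota l \in R ->
        b * (a - iota k) + iota k * (b - iota l) \in R.
      move=> kR lR; have wR := spec_weak R.
      exact: (weak_idealD wR (weak_idealM _ wR kR) (weak_idealM _ wR lR)).
    by split; apply: R.
have mem (R : Spec A) : a - iota k \in R -> (a \in R) = (k == 0).
  move=> kR; apply/idP/eqP => [aR|k0]; last by rewrite k0 rmorph0 subr0 in kR.
  apply/eqP/negPn/negP => k0; have := spec1 R.
  rewrite -(rmorph1 iota) -(mulVf k0) rmorphM specM.
  rewrite -[iota k](subKr a) (weak_idealB (spec_weak R) aR kR) orbT //.
by rewrite !mem.
Qed.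

(** [regular_bound] with W all of V and t = 0 would give |V| + |P| <= |V|. *)
Lemma cell_origin_singular (M : Spec A) : P != fset0 ->
  (forall f, (pi f \in M) = (cell_eval idfun (fun=> 0) f == 0)) ->
  ~ regular_local_ring (localization M).
Proof.
move=> P0 ME reg.
have ind : indep iota M (fun=> 0) 0.
  move=> p; rewrite [ieval _ _ _ _]/(pi p%:MP_[#|{: V}|]) ME cell_evalC => /eqP.
  exact.
have := @regular_bound K P primeI K idfun (fun=> 0) [set: V] M _ 0%N ME
  (fun _ _ => erefl) (fun _ _ _ _ => erefl) ind reg.
by rewrite cardsT addn0 -{2}[#|_|]addn0 leq_add2l leqn0 cardfs_eq0 (negPf P0).
Qed.

(** The generic point of the coordinate axis of v, with coordinates in K(X). *)
Definition axis_point (v w : V) : {fraction iterpoly K 1} :=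
  if w == v then tofrac (ivar K 1 0) else 0.

(** Each term of a minor is a product of two distinct variables, at least one of which vanishes on
    the axis. *)
Lemma cell_axis_spec v : exists Q : Spec A,
  forall f, (pi f \in Q) = (cell_eval (frac_const K 1) (axis_point v) f == 0).
Proof.
have axisM (a b : V) : a != b -> axis_point v a * axis_point v b = 0.
  move=> ab; rewrite /axis_point; case: eqP => [<-|_]; last by rewrite mul0r.
  by rewrite eq_sym (negPf ab) mulr0.
apply: quot_ker_spec; apply: cell_eval_ideal => a b c d [/andP[lt1 lt2] _] ec ed.
have ab : a != b by apply: contraTneq lt1 => ->; rewrite ltxx.
have cd : c != d.
  apply: contraTneq lt1 => e; move: ed; rewrite -e ec => -[-> _].
  by rewrite ltxx.
by rewrite !axisM.
Qed.

Section Axis.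
Variables (v : V) (Q M : Spec A).
Hypothesis QE : forall f, (pi f \in Q) = (cell_eval (frac_const K 1) (axis_point v) f == 0).
Hypothesis ME : forall f, (pi f \in M) = (cell_eval idfun (fun=> 0) f == 0).

Lemma axis_var_notin : x v \notin Q.
Proof. by rewrite QE cell_evalX /axis_point eqxx tofrac_eq0 ivar_neq0. Qed.

Lemma origin_var_in w : x w \in M.
Proof. by rewrite ME cell_evalX. Qed.

(** Evaluation on the axis takes values in K[X], and setting X = 0 there gives evaluation at the
    origin. *)
Lemma axis_sub_origin : {subset Q <= M}.
Proof.
move=> a; have [f <-] := quot_pi_surj a.
pose y w := if w == v then ivar K 1 0 else 0.
have e1 : cell_eval (frac_const K 1) (axis_point v) f = tofrac (cell_eval (iconst K 1) y f).
  rewrite (cell_eval_rmorph (rho' := frac_const K 1) (h := @tofrac _)) //.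
  congr (cell_eval _ _ f); apply/funext => w; rewrite /axis_point /y /=.
  by case: eqP => // _; rewrite tofrac0.
have e2 : cell_eval idfun (fun=> 0) f = ieval idfun (fun=> 0 : K) 1 (cell_eval (iconst K 1) y f).
  rewrite (cell_eval_rmorph (rho' := idfun)); last exact: ieval_const.
  congr (cell_eval _ _ f); apply/funext => w; rewrite /y /comp.
  by case: eqP => _; rewrite ?rmorph0 // ieval_var.
rewrite -/(pi f) QE ME e1 e2 tofrac_eq0 => /eqP->.
by rewrite rmorph0.
Qed.

Lemma axis_indep : indep iota Q (fun=> x v) 1.
Proof.
move=> p; rewrite -[ieval _ _ _ _](pi_ieval (fun=> cell_var K v)) QE cell_eval_ieval.
rewrite (@eq_ieval _ _ _ _ (fun i => tofrac (ivar K 1 i))) => [|i].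
  by rewrite ieval_frac tofrac_eq0 => /eqP.
by rewrite ltnS leqn0 => /eqP->; rewrite /= cell_evalX /axis_point eqxx.
Qed.

Lemma axis_regular_opposite : regular_local_ring (localization Q) ->
  forall c, c \in P -> opposite P (val v) (far_corner (val v) c).
Proof.
pose opp := [set w : V | `[< opposite P (val v) (val w) >]].
have oppP w : w \in opp -> opposite P (val v) (val w) by rewrite inE => /asboolP.
move=> reg; have leP : (#|` P| <= #|opp|)%N.
  (* W consists of the vertices other than v and not opposite to v; with x v independent modulo Q,
     the bound yields |P| <= |opp|. *)
  have W0 w : w \in ~: (v |: opp) -> axis_point v w = 0.
    by rewrite !inE negb_or /axis_point => /andP[/negPf->].
  have Wopp u w : opposite P (val u) (val w) -> u \in ~: (v |: opp) -> axis_point v w = 0.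
    move=> o; rewrite !inE negb_or /axis_point; case: (w =P v) => // wv /andP[_ /asboolP[]].
    by rewrite -wv; exact: opposite_sym.
  have := regular_bound primeI QE W0 Wopp axis_indep reg.
  rewrite -(cardsC (v |: opp)) [X in (_ <= X)%N]addnC -addnA leq_add2l cardsU1 => le.
  rewrite -(leq_add2l 1); apply: leq_trans le _.
  by rewrite leq_add2r leq_b1.
pose s := [seq near_cell (val v) (val w) | w <- enum opp].
have us : uniq s.
  rewrite map_inj_in_uniq ?enum_uniq // => w w'; rewrite !mem_enum.
  move=> /oppP/oppositeP[n1 n2 _] /oppP/oppositeP[n1' n2' _] e.
  by apply/val_inj; rewrite -(near_cellK n1 n2) e near_cellK.
have sP : {subset s <= P}.
  by move=> _ /mapP[w wopp ->]; apply/near_cell_in/oppP; rewrite -mem_enum.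
(* A list of |opp| >= |P| distinct cells of P exhausts P. *)
have [_ sE] : (size s = size P) * (s =i P).
  by apply: uniq_min_size => //; rewrite size_map -cardE.
move=> c; rewrite -sE => /mapP[w]; rewrite mem_enum => /oppP o ->.
by have /oppositeP[n1 n2 _] := o; rewrite near_cellK.
Qed.

End Axis.

(** * Regularity away from the origin for an interval *)

Section Interval.
Hypothesis intP : is_inner_interval P.

Lemma interval_cross (v w : Z2) : v \in V -> w \in V -> (v.1, w.2) \in V.
Proof.
case: intP => -[a1 a2] [[b1 b2] [_ PE]].
case: v w => [v1 v2] [w1 w2] /verticesP[[c1 c2] + +] /verticesP[[d1 d2] + +].
rewrite !PE !cell_verticesP !cell_ofE /= => h1 h2 h3 h4.
by apply/verticesP; exists (c1, d2); rewrite ?PE ?cell_verticesP ?cell_ofE /=; lia.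
Qed.

Lemma interval_opposite (v w : Z2) : v \in V -> w \in V -> v.1 != w.1 -> v.2 != w.2 ->
  opposite P v w.
Proof.
case: intP => -[a1 a2] [[b1 b2] [_ PE]].
case: v w => [v1 v2] [w1 w2] /verticesP[[c1 c2] + +] /verticesP[[d1 d2] + +].
rewrite !PE !cell_verticesP !cell_ofE /= => h1 h2 h3 h4 n1 n2.
apply/oppositeP; split=> //= -[e1 e2] /=; rewrite PE cell_ofE /=; lia.
Qed.

Variables (v : V) (Q : Spec A).
Hypothesis vQ : x v \notin Q.

Let T : {set V} := [set w | ((val w).1 == (val v).1) || ((val w).2 == (val v).2)].
Let n := #|T|.
Let s i : S := nth 0 (map (@cell_var K P) (enum T)) i.
Let phi := ieval iota (pi \o s) n.

(** The variable attached to a vertex of the cross T; for any other point the index is n, where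
    [ivar] is 0. *)
Let z (u : Z2) : {fraction iterpoly K n} := tofrac (ivar K n (index u (map val (enum T)))).

Lemma cross_var (w : V) : w \in T -> exists i, [/\ (i < n)%N, s i = cell_var K w &
  z (val w) = tofrac (ivar K n i)].
Proof.
move=> wT; exists (index w (enum T)); have lti : (index w (enum T) < n)%N.
  by rewrite /n cardE index_mem mem_enum.
split=> //; last by rewrite /z index_map //; exact: val_inj.
by rewrite /s (nth_map v) ?nth_index ?mem_enum // -cardE.
Qed.

(** For w off the cross, x v * x w is the product of two variables of the cross, and x v is outside
    Q. *)
Lemma cross_frac a : has_frac iota (pi \o s) n Q a.
Proof.
elim/cell_ind: a => [k|w|a b|a b]; [|move: w|exact: has_fracD|exact: has_fracM].
  by rewrite -(ieval_const iota (pi \o s) n); exact: has_frac_img.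
have TP w : w \in T -> has_frac iota (pi \o s) n Q (x w).
  move=> /cross_var[i [lti si _]]; rewrite /cell_x -si -[pi (s i)]/((pi \o s) i).
  by rewrite -(ieval_var iota (pi \o s) lti); exact: has_frac_img.
move=> w; have [/TP//|] := boolP (w \in T).
rewrite inE negb_or => /andP[n1 n2].
have Vp := interval_cross (valP v) (valP w); have Vq := interval_cross (valP w) (valP v).
have vw : opposite P (val v) (val w).
  by apply: interval_opposite (valP v) (valP w) _ _; rewrite eq_sym.
apply: (has_frac_solve vQ _ _ (cell_x_opposite (p := [` Vp]%fset) (q := [` Vq]%fset) vw _ _)) => //.
  by apply: TP; rewrite inE eqxx.
by apply: has_fracM; apply: TP; rewrite inE /= eqxx ?orbT.
Qed.

(* Sends x_w to x_(w1,v2) x_(v1,w2) / x_v, where the three vertices lie in the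
   cross T: the parametrization of the matrices of rank one whose entry at v is
   invertible. *)
Let segre (w : V) := z ((val w).1, (val v).2) * z ((val v).1, (val w).2) / z (val v).

(** [segre] satisfies every minor and sends the variables of the cross T to independent variables,
    so a relation among them in A is already trivial. *)
Lemma cross_inj p : phi p = 0 -> p = 0.
Proof.
rewrite /phi -pi_ieval => /eqP; rewrite quot_pi_eq0.
have segreI f : f \in I -> cell_eval (frac_const K n) segre f = 0.
  apply: cell_eval_ideal => a b c d _ ec ed.
  by rewrite /segre ec ed /=; ring.
move=> /segreI; rewrite cell_eval_ieval.
have vT : v \in T by rewrite inE eqxx.
have zv : z (val v) != 0.
  by have [i [lti _ ->]] := cross_var vT; rewrite tofrac_eq0 ivar_neq0.
rewrite (@eq_ieval _ _ _ _ (fun i => tofrac (ivar K n i))) => [|i lti].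
  by rewrite ieval_frac => /eqP; rewrite tofrac_eq0 => /eqP.
have ltiT : (i < size (enum T))%N by rewrite -cardE.
rewrite /= /s (nth_map v) // cell_evalX; set w := nth v _ _.
have wT : w \in T by rewrite -mem_enum mem_nth.
have -> : tofrac (ivar K n i) = z (val w).
  rewrite /z index_map; last exact: val_inj.
  by rewrite index_uniq ?enum_uniq.
rewrite /segre; move: wT; rewrite inE => /orP[]/eqP e.
  by rewrite e -surjective_pairing -e -surjective_pairing mulrAC divff ?mul1r // e.
by rewrite e -e -surjective_pairing e -surjective_pairing mulfK.
Qed.

Lemma interval_regular : regular_local_ring (localization Q).
Proof.
apply: (regular_localization_birational (s := pi \o s) cross_inj cross_frac).
  exact: fg_ring_cell.
exact: cell_domain.
Qed.

End Interval.

(** There are no vertices, so A consists of constants: the birational criterion applies with zero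
    variables. *)
Lemma empty_regular (Q : Spec A) : P = fset0 -> regular_local_ring (localization Q).
Proof.
move=> P0; apply: (@regular_localization_birational K A iota (fun=> 0) 0).
- by move=> k /eqP; rewrite fmorph_eq0 => /eqP.
- move=> a; suff : has_frac iota (fun=> 0) 0 Q a by [].
  elim/cell_ind: a => [k|v|a b|a b]; [| |exact: has_fracD|exact: has_fracM].
    exact: (has_frac_img iota (fun=> 0) Q (k : iterpoly K 0)).
  by have /verticesP[c cP] := valP v; exfalso; move: cP; rewrite P0.
- exact: fg_ring_cell.
- exact: cell_domain.
Qed.

Lemma isolated_iff_interval : isolated_singularity A <-> is_inner_interval P.
Proof.
have [M ME] := cell_origin_spec.
have Mx w : x w \in M by exact: origin_var_in.
split=> [iso|intP].
  have P0 : P != fset0.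
    apply/eqP => P0; have [Q] := isolated_singularity_nonempty iso.
    by apply; exact: empty_regular.
  apply: corners_inner_interval => // v c vV cP.
  have [Q QE] := cell_axis_spec [` vV]%fset.
  (* If the axis prime Q were singular, Q and M would be comparable singular primes, forcing M
     inside Q; but x v lies in M and not in Q. *)
  apply: (axis_regular_opposite QE) cP; apply: contrapT => ZQ.
  have := isolated_singularity_antichain iso ZQ (cell_origin_singular P0 ME) (axis_sub_origin QE ME).
  by move=> /(_ _ (Mx [` vV]%fset)); rewrite (negPf (axis_var_notin QE)).
have P0 : P != fset0.
  case: intP => -[a1 a2] [[b1 b2] [/andP[/= lt1 lt2] PE]].
  by apply/fset0Pn; exists (a1, a2); rewrite PE cell_ofE /= !lexx lt1.
apply: (@isolated_singularity1 _ M); first exact: cell_origin_singular.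
(* A singular prime contains every variable, hence equals M. *)
move=> Q ZQ; apply: cell_spec_origin => // v; apply/negPn/negP => vQ.
by apply: ZQ; exact: interval_regular vQ.
Qed.

End CellTheorem.

Theorem theorem2p1 (K : fieldType) (P : {fset Z2}) :
  perfect_field K ->
  prime_ideal (cell_ideal K P) ->
  isolated_singularity {ideal_quot (cell_ideal K P)} <-> is_inner_interval P.
Proof. by move=> _; exact: isolated_iff_interval. Qed.
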